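(* Let $q\geq 4$ be a prime power and let $C_q$ be the Veronese code over $\mathbb{F}_q$. Then all higher weight spectra $A_w^{(r)}$ of $C_q$ are $0$, with the following exceptions: \[ \begin{array}{ll} A_{q^2-q}^{(1)}=\frac{q^4+2q^3+2q^2+q}{2}, & A_{q^2}^{(1)}=q^5+q+1,\\ A_{q^2+q}^{(1)}=\frac{q^4-q}{2}, & A_{q^2-1}^{(2)}=q^4+q^3+q^2,\\ A_{q^2}^{(2)}=q^3+2q^2+2q+1, & A_{q^2+q-3}^{(2)}=\frac{q^8-q^6-q^5+q^3}{24},\\ A_{q^2+q-2}^{(2)}=\frac{q^7+q^6-q^4-q^3}{2}, & A_{q^2+q-1}^{(2)}=\frac{q^8+5q^6+7q^5+4q^4-q^3-4q^2}{4},\\ A_{q^2+q}^{(2)}=\frac{2q^8+3q^7+q^6+4q^5+9q^4+5q^3-6q}{6}, & A_{q^2+q+1}^{(2)}=\frac{3q^8+q^6-3q^5-q^3}{8},\\ A_{q^2}^{(3)}=q^2+q+1, & A_{q^2+q-2}^{(3)}=\frac{q^6+2q^5+2q^4+q^3}{6},\\ A_{q^2+q-1}^{(3)}=\frac{q^7+2q^6+3q^5+3q^4+2q^3+q^2}{2}, & A_{q^2+q}^{(3)}=\frac{2q^8+2q^7+3q^6+2q^5+4q^4+3q^3+2q^2}{2},\\ A_{q^2+q+1}^{(3)}=\frac{6q^9+3q^7+2q^6+q^5-5q^4+2q^3-3q^2}{6}, & A_{q^2+q-1}^{(4)}=\frac{q^4+2q^3+2q^2+q}{2},\\ A_{q^2+q}^{(4)}=q^6+2q^5+2q^4+q^3+q^2+q+1,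 & A_{q^2+q+1}^{(4)}=\frac{2q^8+2q^7+2q^6+q^4-q}{2},\\ A_{q^2+q}^{(5)}=q^2+q+1, & A_{q^2+q+1}^{(5)}=q^5+q^4+q^3,\\ A_{q^2+q+1}^{(6)}=1. & \end{array} \]
   Context: Let $q$ be a prime power. Fix an ordering of the $q^2+q+1$ points of the projective plane $\mathbb{P}^2$ over $\mathbb{F}_q$ and a coordinate representative $(x,y,z)$ of each. The Veronese code $C_q$ is the linear $[q^2+q+1,6]_q$ code with generator matrix $G_q$ whose columns are the vectors $(x^2,xy,xz,y^2,yz,z^2)$ for the chosen representatives, in the fixed order; equivalently its codewords are the vectors of values of homogeneous quadratic polynomials in $x,y,z$ at the points of $\mathbb{P}^2(\mathbb{F}_q)$. For a subcode $D$ of a linear code of length $n$, its support is the set of coordinates $i$ such that some codeword of $D$ has nonzero $i$-th entry, and its weight $wt(D)$ is the cardinality of the support. For $1\le r\le k$ and $0\le w\le n$, the higher weight spectrum $A_w^{(r)}$ of an $[n,k]$ code is the number of subcodes of dimension $r$ and weight $w$. *)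

(* Defs.v *)
From HB Require Import structures.
From mathcomp Require Import all_boot all_order all_algebra.

Set Implicit Arguments.
Unset Strict Implicit.
Unset Printing Implicit Defensive.

Import GRing.Theory.
Local Open Scope ring_scope.

(* The subspaces of a vector space over a finite field form a finite type,   *)
(* so that subcodes can be counted with #|_|.                                *)
Section FiniteVspace.
Import VectorInternalTheory.
Variables (F : finFieldType) (vT : vectType F).
HB.instance Definition _ := [Countable of {vspace vT} by <:].
HB.instance Definition _ := [Finite of {vspace vT} by <:].
End FiniteVspace.

Section Codes.
Variables (F : finFieldType) (n : nat).
Implicit Types C D : {vspace 'rV[F]_n}.

Definition code_of_generator k (G : 'M[F]_(k, n)) : {vspace 'rV[F]_n} :=
  <<[seq row i G | i : 'I_k]>>%VS.

Definition support D : {set 'I_n} :=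
  [set i | [exists v : 'rV[F]_n, (v \in D) && (v 0 i != 0)]].

Definition wt D : nat := #|support D|.

Definition higher_weight_spectrum C (r w : nat) : nat :=
  #|[set D : {vspace 'rV[F]_n} | [&& (D <= C)%VS, \dim D == r & wt D == w]]|.

End Codes.

Section Veronese.
Variable F : finFieldType.

(* Points of the projective plane are the lines through the origin of F^3;   *)
(* P enumerates them without repetition, P i representing the i-th one.      *)
Definition projective_plane_reps n (P : 'I_n -> 'rV[F]_3) : Prop :=
  [/\ forall i, P i != 0,
      injective (fun i => <[P i]>%VS)
    & forall L : {vspace 'rV[F]_3}, \dim L = 1%N -> exists i, L = <[P i]>%VS].

Definition veronese (v : 'rV[F]_3) : 6.-tuple F :=
  let x := v 0 0 in let y := v 0 1 in let z := v 0 2%:R in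
  [tuple x ^+ 2; x * y; x * z; y ^+ 2; y * z; z ^+ 2].

Definition veronese_mx n (P : 'I_n -> 'rV[F]_3) : 'M[F]_(6, n) :=
  \matrix_(i < 6, j < n) tnth (veronese (P j)) i.

Definition veronese_code n (P : 'I_n -> 'rV[F]_3) : {vspace 'rV[F]_n} :=
  code_of_generator (veronese_mx P).

End Veronese.

(* Entries ((r, w), a) stand for A_w^(r) = a; the weights w, natural numbers *)
(* with truncated subtraction, are exact as soon as 1 < q.                   *)
Definition veronese_spectra (q : nat) : seq ((nat * nat) * rat) :=
  let Q : rat := q%:R in
  [:: ((1, q ^ 2 - q)%N,
        (Q ^+ 4 + 2 * Q ^+ 3 + 2 * Q ^+ 2 + Q) / 2);
      ((1, q ^ 2)%N, Q ^+ 5 + Q + 1);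
      ((1, q ^ 2 + q)%N, (Q ^+ 4 - Q) / 2);
      ((2, q ^ 2 - 1)%N, Q ^+ 4 + Q ^+ 3 + Q ^+ 2);
      ((2, q ^ 2)%N, Q ^+ 3 + 2 * Q ^+ 2 + 2 * Q + 1);
      ((2, q ^ 2 + q - 3)%N, (Q ^+ 8 - Q ^+ 6 - Q ^+ 5 + Q ^+ 3) / 24);
      ((2, q ^ 2 + q - 2)%N, (Q ^+ 7 + Q ^+ 6 - Q ^+ 4 - Q ^+ 3) / 2);
      ((2, q ^ 2 + q - 1)%N,
        (Q ^+ 8 + 5 * Q ^+ 6 + 7 * Q ^+ 5 + 4 * Q ^+ 4 - Q ^+ 3
           - 4 * Q ^+ 2) / 4);
      ((2, q ^ 2 + q)%N,
        (2 * Q ^+ 8 + 3 * Q ^+ 7 + Q ^+ 6 + 4 * Q ^+ 5 + 9 * Q ^+ 4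
           + 5 * Q ^+ 3 - 6 * Q) / 6);
      ((2, q ^ 2 + q + 1)%N,
        (3 * Q ^+ 8 + Q ^+ 6 - 3 * Q ^+ 5 - Q ^+ 3) / 8);
      ((3, q ^ 2)%N, Q ^+ 2 + Q + 1);
      ((3, q ^ 2 + q - 2)%N,
        (Q ^+ 6 + 2 * Q ^+ 5 + 2 * Q ^+ 4 + Q ^+ 3) / 6);
      ((3, q ^ 2 + q - 1)%N,
        (Q ^+ 7 + 2 * Q ^+ 6 + 3 * Q ^+ 5 + 3 * Q ^+ 4 + 2 * Q ^+ 3
           + Q ^+ 2) / 2);
      ((3, q ^ 2 + q)%N,
        (2 * Q ^+ 8 + 2 * Q ^+ 7 + 3 * Q ^+ 6 + 2 * Q ^+ 5 + 4 * Q ^+ 4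
           + 3 * Q ^+ 3 + 2 * Q ^+ 2) / 2);
      ((3, q ^ 2 + q + 1)%N,
        (6 * Q ^+ 9 + 3 * Q ^+ 7 + 2 * Q ^+ 6 + Q ^+ 5 - 5 * Q ^+ 4
           + 2 * Q ^+ 3 - 3 * Q ^+ 2) / 6);
      ((4, q ^ 2 + q - 1)%N,
        (Q ^+ 4 + 2 * Q ^+ 3 + 2 * Q ^+ 2 + Q) / 2);
      ((4, q ^ 2 + q)%N,
        Q ^+ 6 + 2 * Q ^+ 5 + 2 * Q ^+ 4 + Q ^+ 3 + Q ^+ 2 + Q + 1);
      ((4, q ^ 2 + q + 1)%N,
        (2 * Q ^+ 8 + 2 * Q ^+ 7 + 2 * Q ^+ 6 + Q ^+ 4 - Q) / 2);
      ((5, q ^ 2 + q)%N, Q ^+ 2 + Q + 1);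
      ((5, q ^ 2 + q + 1)%N, Q ^+ 5 + Q ^+ 4 + Q ^+ 3);
      ((6, q ^ 2 + q + 1)%N, 1)].

(* Main.v *)
Require Import Defs.
From mathcomp Require Import all_boot all_order all_algebra.
From mathcomp Require Import finfield zify ring lra.

(* Call D a linear system of conics of dimension r: its weight is n minus the number of its
   base points. Double counting pairs (D, T) with T a t-set of base points of D gives the t-th
   binomial moment of the distribution of base points as a sum over T of Gaussian binomials in
   the dimension of the system of all conics through T. Products of two lines show that this
   dimension is 6 - t for t <= 3, and 2 or 3 for t = 4, according to whether the conics through
   T contain the line spanned by T. For each r only a few numbers of base points are possible:
   0, 1, q + 1, 2q + 1 for a conic; at most 4, q + 1, q + 2 for a pencil; at most 3, q + 1 for
   a net; at most 6 - r if r >= 4. So the moments determine the spectra, once the number of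
   collinear 4-sets and of pencils with a line of base points are known. The former follows
   from the fourth moment of single conics, and gives the number of lines by the fourth moment
   of nets; a pencil of the latter kind is a line times a pencil of lines. *)

Set Implicit Arguments.
Unset Strict Implicit.
Unset Printing Implicit Defensive.

Import Order.TTheory GRing.Theory Num.Theory.
Local Open Scope ring_scope.

(** * Counting subspaces over a finite field *)

Section CountSubspaces.
Variables (F : finFieldType) (n : nat).
Implicit Types D W : {vspace 'rV[F]_n}.

(** Induction on r: a free r-tuple extends by any vector of W outside its span, and the span has q^r
    elements. *)
Lemma card_free_tuples W r :
  #|[set X : r.-tuple 'rV[F]_n | free X && (<<X>> <= W)%VS]|
  = (\prod_(i < r) (#|F| ^ \dim W - #|F| ^ i))%N.
Proof.
elim: r => [|r IHr].
  rewrite big_ord0; apply: (@eq_card1 _ [tuple]) => X.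
  by rewrite !inE (tuple0 X) /= nil_free span_nil sub0v.
rewrite big_ord_recr /= -IHr.
pose g (X : r.+1.-tuple 'rV[F]_n) : r.-tuple 'rV[F]_n := [tuple of behead X].
rewrite -sum_nat_const -sum1_card.
rewrite (partition_big g
  [in [set X : r.-tuple 'rV[F]_n | free X && (<<X>> <= W)%VS]]) /=; last first.
  move=> X; case/tupleP: X => v X; rewrite !inE /= free_cons span_cons subv_add.
  rewrite /g; case/andP=> /andP [_ fX] /andP [_ sX].
  by rewrite fX sX.
apply: eq_bigr => X; rewrite inE => /andP [fX sX].
have -> : (#|F| ^ r = #|[predI W & <<X>>%VS]|)%N.
  transitivity #|<<X>>%VS|; last first.
    apply: eq_card => v; rewrite !inE; case vX: (v \in <<X>>%VS); last by rewrite andbF.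
    by rewrite (subvP sX).
  by rewrite card_vspace; move: fX; rewrite /free => /eqP ->; rewrite size_tuple.
rewrite -card_vspace -(cardID [in <<X>>%VS] W) addKn sum1_card.
rewrite -(card_imset [predD W & <<X>>%VS] (f := fun v => [tuple of v :: X])); last first.
  by move=> u v /(congr1 val) [].
apply: eq_card => Y; apply/idP/imsetP => [|[v]].
  case/tupleP: Y => v Y; rewrite unfold_in !inE /= free_cons span_cons subv_add.
  case/andP=> /andP[/andP [vY fY] /andP [sv sY]] /eqP E.
  have {}E : Y = X by apply/val_inj; rewrite -E.
  by exists v; rewrite ?E // !inE -E vY memvE.
rewrite !inE => /andP [vX vW] ->; rewrite unfold_in !inE /=.
rewrite free_cons vX fX span_cons subv_add -memvE vW sX /=.
by apply/eqP/val_inj.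
Qed.

(** Fibre the free r-tuples of W over their spans; the fibre over D consists of the ordered bases of
    D. The product form stays valid for r > dim W, where both sides are 0. *)
Lemma card_subspaces W r :
  (#|[set D | (D <= W)%VS && (\dim D == r)]| *
     \prod_(i < r) (#|F| ^ r - #|F| ^ i) =
   \prod_(i < r) (#|F| ^ \dim W - #|F| ^ i))%N.
Proof.
rewrite -card_free_tuples -sum_nat_const.
rewrite -[RHS]sum1_card.
rewrite (partition_big (fun X : r.-tuple 'rV[F]_n => <<X>>%VS)
  [in [set D : {vspace 'rV[F]_n} | (D <= W)%VS && (\dim D == r)]]) /=; last first.
  move=> X; rewrite !inE => /andP [fX ->] /=.
  by move: fX; rewrite /free size_tuple.
apply: eq_bigr => D; rewrite inE => /andP [sD /eqP dD].
have := card_free_tuples D r; rewrite dD => <-; rewrite sum1_card; apply: eq_card => X.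
rewrite inE [RHS]unfold_in !inE /free size_tuple; apply/idP/idP.
  case/andP=> dX sX; rewrite dX (subv_trans sX sD) /=.
  by rewrite eqEdim sX dD (eqP dX) leqnn.
by case/andP=> /andP [-> _] /eqP -> /=.
Qed.

End CountSubspaces.

(** * Binomial moments of the number of zeros *)

Section Zeros.
Variables (F : finFieldType) (n : nat).
Implicit Types (D C : {vspace 'rV[F]_n}) (T : {set 'I_n}) (i : 'I_n).

Definition zeros D : {set 'I_n} := ~: Defs.support D.

Definition vanishing_at i : {vspace 'rV[F]_n} := lker (linfun (col i : 'rV[F]_n -> 'cV[F]_1)).

(** The shortened code of coding theory, with the coordinates in T kept. For the Veronese code it is
    the linear system of conics through T. *)
Definition shortened C T : {vspace 'rV[F]_n} :=
  (C :&: \bigcap_(i in T) vanishing_at i)%VS.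

Lemma mem_vanishing_at i (v : 'rV[F]_n) : (v \in vanishing_at i) = (v 0 i == 0).
Proof.
rewrite memv_ker lfunE /=; apply/eqP/eqP => [/colP/(_ 0)|v0]; first by rewrite !mxE.
by apply/colP => k; rewrite !mxE ord1 v0.
Qed.

Lemma zerosP D i : reflect (forall v, v \in D -> v 0 i = 0) (i \in zeros D).
Proof.
rewrite !inE negb_exists; apply: (iffP forallP) => [h v vD|h v].
  by apply/eqP; have := h v; rewrite vD negbK.
by rewrite negb_and negbK; case vD: (v \in D); rewrite ?orbT //= h.
Qed.

Lemma shortenedP C T v :
  reflect (v \in C /\ forall i, i \in T -> v 0 i = 0) (v \in shortened C T).
Proof.
rewrite memv_cap; apply: (iffP andP) => -[vC h]; split=> //.
  move=> i iT; apply/eqP; rewrite -mem_vanishing_at.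
  by move: h; rewrite memvE => /subv_bigcapP/(_ i iT); rewrite -memvE.
rewrite memvE; apply/subv_bigcapP => i iT.
by rewrite -memvE mem_vanishing_at h.
Qed.

Lemma sub_shortened C T D : (D <= shortened C T)%VS = (D <= C)%VS && (T \subset zeros D).
Proof.
apply/idP/andP => [/subvP h|[/subvP sDC /subsetP h]].
  split; first by apply/subvP => v /h /shortenedP [].
  by apply/subsetP => i iT; apply/zerosP => v /h /shortenedP [_ ->].
apply/subvP => v vD; apply/shortenedP; split; first exact: sDC.
by move=> i /h /zerosP ->.
Qed.

Lemma shortened0 C : shortened C set0 = C.
Proof. by rewrite /shortened big_set0 capvf. Qed.

Lemma shortenedU1 C T i : shortened C (i |: T) = (shortened C T :&: vanishing_at i)%VS.
Proof.
apply/vspaceP => v; rewrite memv_cap mem_vanishing_at.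
apply/shortenedP/andP => [[vC h]|[/shortenedP [vC h] /eqP vi]].
  split; last by rewrite h ?setU11.
  by apply/shortenedP; split => // j jT; rewrite h // setU1r.
by split => // j; rewrite !inE => /orP [/eqP -> //|/h].
Qed.

(** Rank-nullity for the i-th coordinate form on D, whose image has dimension 0 or 1. *)
Lemma dim_cap_vanishing D i :
  (\dim D = \dim (D :&: vanishing_at i) + (i \notin zeros D))%N.
Proof.
set f := linfun (col i : 'rV[F]_n -> 'cV[F]_1).
rewrite -(limg_ker_dim f D); congr (_ + _)%N.
case: zerosP => /= h.
  apply/eqP; rewrite dimv_eq0 -subv0; apply/subvP => w /memv_imgP [v vD ->].
  by rewrite memv0 lfunE /=; apply/eqP/colP => k; rewrite !mxE ord1 h.
apply/eqP; rewrite eqn_leq; apply/andP; split.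
  by apply: (leq_trans (dimvS (subvf _))); rewrite dimvf dim_matrix.
rewrite lt0n dimv_eq0; apply/negP => /eqP f0; apply: h => v vD.
have := memv_img f vD; rewrite f0 memv0 lfunE /= => /eqP/colP/(_ 0).
by rewrite !mxE.
Qed.

Lemma dim_shortenedU1 C T i :
  (\dim (shortened C T) = \dim (shortened C (i |: T)) + (i \notin zeros (shortened C T)))%N.
Proof. by rewrite shortenedU1 -dim_cap_vanishing. Qed.

Lemma dim_shortenedU1_sep C T i c :
  c \in shortened C T -> c 0 i != 0 ->
  \dim (shortened C T) = (\dim (shortened C (i |: T))).+1.
Proof.
move=> cC ci; rewrite (dim_shortenedU1 C T i); case: zerosP; rewrite ?addn1 // => h.
by rewrite h ?eqxx in ci.
Qed.

Definition subcodes C r : {set {vspace 'rV[F]_n}} :=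
  [set D | (D <= C)%VS && (\dim D == r)].

Lemma moment_zeros C r t :
  (\sum_(D in subcodes C r) 'C(#|zeros D|, t) =
   \sum_(T : {set 'I_n} | #|T| == t) #|subcodes (shortened C T) r|)%N.
Proof.
under eq_bigr do rewrite -cards_draws -sum1_card big_mkcond /=.
rewrite exchange_big /= [RHS]big_mkcond /=; apply: eq_bigr => T _.
case: ifP => [tT|/negbT tT].
  rewrite -sum1_card [RHS]big_mkcond [LHS]big_mkcond /=; apply: eq_bigr => D _.
  rewrite !inE sub_shortened tT andbT.
  by case: (D <= C)%VS; case: (\dim D == r) => //=; case: (T \subset _).
by apply: big1 => D _; rewrite inE (negPf tT) andbF.
Qed.

Definition spectrum_zeros C r m : nat := #|[set D in subcodes C r | #|zeros D| == m]|.

(** The bound matters: for w > n the truncated n - w would be 0, the value that belongs to w = n. *)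
Lemma higher_weight_zeros C r w : (w <= n)%N ->
  higher_weight_spectrum C r w = spectrum_zeros C r (n - w)%N.
Proof.
move=> wn; apply: eq_card => D; rewrite !inE /zeros cardsCs setCK card_ord /wt -andbA.
congr [&& _, _ & _].
have := max_card (Defs.support D); rewrite card_ord; lia.
Qed.

(** Turns each binomial moment into a linear equation in finitely many unknown spectra. *)
Lemma sum_zeros C r (s : seq nat) (f : nat -> nat) : uniq s ->
  (forall D, D \in subcodes C r -> #|zeros D| \in s) ->
  (\sum_(D in subcodes C r) f #|zeros D| = \sum_(m <- s) spectrum_zeros C r m * f m)%N.
Proof.
move=> us hs.
transitivity (\sum_(D in subcodes C r) \sum_(m <- s) (#|zeros D| == m) * f m)%N.
  apply: eq_bigr => D /hs zs; rewrite (bigD1_seq #|zeros D|) //= eqxx mul1n.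
  by rewrite big1 ?addn0 // => m; rewrite eq_sym => /negPf ->.
rewrite exchange_big /=; apply: eq_bigr => m _.
rewrite -big_distrl /=; congr (_ * _)%N.
rewrite /spectrum_zeros -sum1_card [RHS]big_mkcond [LHS]big_mkcond; apply: eq_bigr => D _ /=.
by rewrite !inE; case: ifP => //= _; case: eqP.
Qed.

End Zeros.

(** * Conics and codewords *)

Lemma mem_code_of_generator (F : finFieldType) (n k : nat) (G : 'M[F]_(k, n)) c :
  reflect (exists a : 'rV[F]_k, c = a *m G) (c \in code_of_generator G).
Proof.
rewrite /code_of_generator; apply: (iffP idP) => [cC|[a ->]].
  have -> : c = \sum_(i < k) coord (image_tuple (fun i : 'I_k => row i G) 'I_k)
      (enum_rank i) c *: row i G.
    rewrite [LHS](coord_span (X := image_tuple (fun i : 'I_k => row i G) 'I_k) cC).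
    rewrite (reindex_onto enum_rank enum_val) /=; last by move=> j _; rewrite enum_valK.
    under eq_bigl => j do rewrite enum_rankK eqxx.
    by apply: eq_bigr => j _; rewrite nth_image enum_rankK.
  exists (\row_i coord (image_tuple (fun i : 'I_k => row i G) 'I_k) (enum_rank i) c).
  by rewrite mulmx_sum_row; apply: eq_bigr => i _; rewrite mxE.
rewrite mulmx_sum_row; apply: memv_suml => i _; apply/memvZ/memv_span.
by apply/imageP; exists i.
Qed.

Lemma dim_code_of_generator (F : finFieldType) (n k : nat) (G : 'M[F]_(k, n)) :
  (forall a : 'rV[F]_k, a *m G = 0 -> a = 0) -> \dim (code_of_generator G) = k.
Proof.
move=> inj; have Ek : size [seq row i G | i : 'I_k] = k by rewrite size_image card_ord.
rewrite -[RHS]Ek; apply/eqP.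
apply/(@freeP _ _ _ (image_tuple (fun i : 'I_k => row i G) 'I_k)) => b b0 i.
have := inj (\row_i b (enum_rank i)); rewrite mulmx_sum_row.
move=> /(_ _)/rowP/(_ (enum_val i)); rewrite !mxE enum_valK; apply.
rewrite -[RHS]b0 [RHS](reindex_onto enum_rank enum_val) /=; last by move=> j _; rewrite enum_valK.
under [RHS]eq_bigl => j do rewrite enum_rankK eqxx.
by apply: eq_bigr => j _; rewrite mxE nth_image enum_rankK.
Qed.

Section Conics.
Variable F : finFieldType.
Implicit Types (A M : 'M[F]_3) (u v : 'rV[F]_3).

(** The matrix of the quadratic form is arbitrary rather than symmetric, so that characteristic 2 is
    covered; the form depends only on the diagonal and on the sums A i j + A j i. *)
Definition conic A v : F := (v *m A *m v^T) 0 0.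

Lemma sum_ord3 (f : 'I_3 -> F) : \sum_i f i = f 0 + f 1 + f 2%:R.
Proof.
rewrite !big_ord_recl big_ord0 addr0 addrA.
by congr (_ + f _ + f _); apply: val_inj.
Qed.

Definition vec3 (x y z : F) : 'rV[F]_3 := \row_i [:: x; y; z]`_i.

Lemma vec3K v : vec3 (v 0 0) (v 0 1) (v 0 2%:R) = v.
Proof.
apply/rowP => -[[|[|[|//]]] h]; rewrite mxE /=; congr (v 0 _); exact: val_inj.
Qed.

Lemma conic_vec3 A x y z : conic A (vec3 x y z) =
  A 0 0 * x ^+ 2 + (A 0 1 + A 1 0) * (x * y) + (A 0 2%:R + A 2%:R 0) * (x * z)
  + A 1 1 * y ^+ 2 + (A 1 2%:R + A 2%:R 1) * (y * z) + A 2%:R 2%:R * z ^+ 2.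
Proof.
rewrite /conic !mxE sum_ord3 !mxE !sum_ord3 !mxE /=; ring.
Qed.

Lemma conicZ A a v : conic A (a *: v) = a ^+ 2 * conic A v.
Proof. by rewrite /conic linearZ /= -!scalemxAl -scalemxAr scalerA !mxE expr2. Qed.

Lemma conicM A M v : conic A (v *m M) = conic (M *m A *m M^T) v.
Proof. by rewrite /conic trmx_mul !mulmxA. Qed.

Lemma conicD A u v s t : conic A (s *: u + t *: v) =
  s ^+ 2 * conic A u + s * t * ((u *m A *m v^T) 0 0 + (v *m A *m u^T) 0 0) + t ^+ 2 * conic A v.
Proof.
rewrite /conic linearD /= !linearZ /= !mulmxDl !mulmxDr -!scalemxAl -!scalemxAr !mxE; ring.
Qed.

(** The degenerate conic formed by the lines with equations a and b; such conics separate points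
    below. *)
Lemma conic_forms (a b : 'cV[F]_3) v :
  conic (a *m b^T) v = (v *m a) 0 0 * (v *m b) 0 0.
Proof. by rewrite /conic !mulmxA -mulmxA -trmx_mul !mxE big_ord1 !mxE. Qed.

End Conics.

Section Code.
Variables (F : finFieldType) (n : nat) (P : 'I_n -> 'rV[F]_3).

Definition conic_mx (a : 'rV[F]_6) : 'M[F]_3 :=
  \matrix_(i < 3, j < 3) nth 0 (nth [::]
    [:: [:: a 0 0; a 0 1; a 0 2%:R]; [:: 0; a 0 3%:R; a 0 4%:R]; [:: 0; 0; a 0 5%:R]] i) j.

Lemma mul_veronese_mx (a : 'rV[F]_6) j : (a *m veronese_mx P) 0 j = conic (conic_mx a) (P j).
Proof.
rewrite -(vec3K (P j)) conic_vec3 !mxE !big_ord_recl big_ord0 !mxE !(tnth_nth 0) /=.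
rewrite !addr0 !addrA.
by congr (_ + _ + _ + _ + _ + _); congr (a 0 _ * _); apply: val_inj.
Qed.

Lemma mem_veronese_code (c : 'rV[F]_n) :
  reflect (exists A, forall j, c 0 j = conic A (P j)) (c \in veronese_code P).
Proof.
apply: (iffP (mem_code_of_generator _ _)) => [[a ->]|[A hA]].
  by exists (conic_mx a) => j; rewrite mul_veronese_mx.
exists (\row_i [:: A 0 0; A 0 1 + A 1 0; A 0 2%:R + A 2%:R 0; A 1 1;
   A 1 2%:R + A 2%:R 1; A 2%:R 2%:R]`_i).
apply/rowP => j.
by rewrite mul_veronese_mx hA -(vec3K (P j)) !conic_vec3 !mxE /= !addr0.
Qed.

Hypothesis hP : projective_plane_reps P.

Lemma reps_neq0 i : P i != 0. Proof. by case: hP. Qed.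

Lemma reps_inj i j (a : F) : P i = a *: P j -> i = j.
Proof.
case: hP => n0 inj _ E; apply: inj; apply/eqP; rewrite eqEdim.
rewrite !dim_vline !n0 andbT -memvE E; exact/memvZ/memv_line.
Qed.

Lemma reps_surj v : v != 0 -> exists a i, a != 0 /\ v = a *: P i.
Proof.
case: hP => _ _ surj v0.
have [i vi] : exists i, <[v]>%VS = <[P i]>%VS by apply: surj; rewrite dim_vline v0.
have /vlineP [a va] : v \in <[P i]>%VS by rewrite -vi memv_line.
exists a, i; split => //; apply: contra_neq v0 => a0.
by rewrite va a0 scale0r.
Qed.

(** Every nonzero vector is in a unique way a nonzero scalar times a representative. This reduces
    counting points to counting vectors. *)
Lemma card_cone (S : pred 'rV[F]_3) : (forall a v, a != 0 -> S (a *: v) = S v) ->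
  #|[set v | (v != 0) && S v]| = (#|F|.-1 * #|[set i | S (P i)]|)%N.
Proof.
move=> SZ; have -> : #|F|.-1 = #|[set a : F | a != 0]|.
  rewrite -(cardsC1 0); apply: eq_card => a; by rewrite !inE.
rewrite -cardsX -(card_in_imset (f := fun p : F * 'I_n => p.1 *: P p.2)); last first.
  move=> [a i] [b j]; rewrite !inE /= => /andP [a0 _] /andP [b0 _] E.
  have ij : i = j.
    by apply: (@reps_inj i j (a^-1 * b)); rewrite -scalerA -E scalerA mulVf ?scale1r.
  move: E; rewrite ij => /eqP; rewrite -subr_eq0 -scalerBl scaler_eq0 (negPf (reps_neq0 _)) orbF.
  by rewrite subr_eq0 => /eqP ->.
apply: eq_card => v; rewrite inE; apply/andP/imsetP => [[v0 Sv]|[[a i]]].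
  have [a [i [a0 E]]] := reps_surj v0.
  by exists (a, i); rewrite // !inE /= a0 -(SZ a) // -E.
rewrite !inE /= => /andP [a0 Si] ->; rewrite SZ //; split => //.
by rewrite scaler_eq0 negb_or a0 reps_neq0.
Qed.

Lemma conic_reps0 A : (forall i, conic A (P i) = 0) -> forall v, conic A v = 0.
Proof.
move=> h v; have [->|v0] := eqVneq v 0; first by rewrite /conic !mul0mx mxE.
by have [a [i [_ ->]]] := reps_surj v0; rewrite conicZ h mulr0.
Qed.

(** A quadratic form that vanishes at all points vanishes at all vectors, and its values at six
    vectors with entries 0 and 1 determine its coefficients. *)
Lemma dim_veronese_code : \dim (veronese_code P) = 6%N.
Proof.
apply: dim_code_of_generator => a a0.
have h x y z : conic (conic_mx a) (vec3 x y z) = 0.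
  apply: conic_reps0 => j; have /rowP/(_ j) := a0.
  by rewrite mul_veronese_mx mxE.
have := h 1 0 0; rewrite conic_vec3 !mxE /= => h1.
have := h 0 1 0; rewrite conic_vec3 !mxE /= => h2.
have := h 0 0 1; rewrite conic_vec3 !mxE /= => h3.
have := h 1 1 0; rewrite conic_vec3 !mxE /= => h4.
have := h 1 0 1; rewrite conic_vec3 !mxE /= => h5.
have := h 0 1 1; rewrite conic_vec3 !mxE /= => h6.
have e0 : a 0 0 = 0 by rewrite -h1; ring.
have e3 : a 0 3%:R = 0 by rewrite -h2; ring.
have e5 : a 0 5%:R = 0 by rewrite -h3; ring.
have e1 : a 0 1 = 0 by rewrite -h4 e0 e3; ring.
have e2 : a 0 2%:R = 0 by rewrite -h5 e0 e5; ring.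
have e4 : a 0 4%:R = 0 by rewrite -h6 e3 e5; ring.
apply/rowP => -[[|[|[|[|[|[|//]]]]]] k]; rewrite mxE.
- by rewrite -[RHS]e0; congr (a 0 _); apply: val_inj.
- by rewrite -[RHS]e1; congr (a 0 _); apply: val_inj.
- by rewrite -[RHS]e2; congr (a 0 _); apply: val_inj.
- by rewrite -[RHS]e3; congr (a 0 _); apply: val_inj.
- by rewrite -[RHS]e4; congr (a 0 _); apply: val_inj.
- by rewrite -[RHS]e5; congr (a 0 _); apply: val_inj.
Qed.

End Code.

(** * The number of zeros of a conic *)

Section CountConic.
Variable F : finFieldType.
Local Notation q := #|F|.
Implicit Types (f : F -> F -> bool) (a b c x y z t : F).

Lemma sum_all_bool (b : bool) : (\sum_(x : F) b = q * b)%N.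
Proof. by rewrite sum_nat_const. Qed.

Lemma sum_linear_zeros a b : a != 0 -> (\sum_(x : F) (x * a + b == 0)%R = 1)%N.
Proof.
move=> a0; rewrite (bigD1 (- b / a)) //= divfK // addNr eqxx big1 // => x xE.
case: eqP => // /eqP; rewrite addr_eq0 => /eqP E; case/eqP: xE.
by rewrite -E mulfK.
Qed.

Lemma sum_quadratic_zeros a b c : a != 0 ->
  (\sum_(x : F) (a * x ^+ 2 + b * x + c == 0)%R <= 2)%N.
Proof.
move=> a0; rewrite -big_mkcond sum1_card /=.
case: (pickP [pred x | a * x ^+ 2 + b * x + c == 0]) => [y /= /eqP y0|none]; last first.
  by rewrite eq_card0.
(* By Vieta, -b/a - y is the other root. *)
apply: (@leq_trans #|[set y; - b / a - y]|); last by rewrite cards2; case: (_ != _).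
apply: subset_leq_card; apply/subsetP => x; rewrite !inE unfold_in => /eqP x0.
have : a * (x - y) * (x - (- b / a - y)) = 0.
  rewrite -[RHS](subrr (0 : F)) -{1}x0 -y0; field => //.
by move/eqP; rewrite !mulf_eq0 (negPf a0) !subr_eq0.
Qed.

(** The plane consists of the origin and the nonzero multiples of (1, 0) and of the vectors (t,
    1). *)
Lemma sum_cone2 f : (forall s x y, s != 0 -> f (s * x) (s * y) = f x y) ->
  (\sum_y \sum_z f y z = f 0%R 0%R + q.-1 * (f 1%R 0%R + \sum_t f t 1%R))%N.
Proof.
move=> fZ; rewrite exchange_big /= (bigD1 0) //= (bigD1 0) //= -addnA; congr (_ + _)%N.
have cN : #|[pred x : F | x != 0]| = q.-1 by rewrite -(cardC1 0).
rewrite mulnDr; congr (_ + _)%N.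
  rewrite -cN -sum_nat_const; apply: eq_bigr => x x0.
  by rewrite -(fZ x 1 0) // mulr1 mulr0.
rewrite -cN -sum_nat_const; apply: eq_bigr => x x0.
rewrite (reindex_inj (mulfI x0)); apply: eq_bigr => t _.
by rewrite -(fZ x t 1) // mulr1.
Qed.

(** A nonzero binary form has m <= 2 zeros on the projective line, hence 1 + m(q - 1) zeros in the
    plane. *)
Lemma sum_binary_zeros a b c : [|| a != 0, b != 0 | c != 0] ->
  (\sum_y \sum_z (a * y ^+ 2 + b * (y * z) + c * z ^+ 2 == 0)%R \in [:: 1; q; 2 * q - 1])%N.
Proof.
have q1 : (1 < q)%N := finNzRing_gt1 F.
move=> abc; rewrite sum_cone2; last first.
  move=> s y z s0; rewrite (_ : _ + _ + _ = s ^+ 2 * (a * y ^+ 2 + b * (y * z) + c * z ^+ 2)).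
    by rewrite mulf_eq0 expf_eq0 (negPf s0).
  by ring.
rewrite !expr0n /= !mulr0 !expr1n !addr0 eqxx !mulr1.
under eq_bigr do rewrite !mulr1.
have [a0|a0] := eqVneq a 0.
  rewrite a0 /= in abc *.
  have [b0|b0] := eqVneq b 0.
    rewrite b0 eqxx /= in abc *.
    rewrite big1; last by move=> t _; rewrite !mul0r !add0r (negPf abc).
    by rewrite !inE; apply/orP; right; apply/orP; left; move: #|F| q1 => k; lia.
  under eq_bigr do rewrite mul0r add0r mulrC.
  by rewrite sum_linear_zeros // !inE; lia.
have := sum_quadratic_zeros b c a0; move: (\sum_x _)%N => k.
by case: k => [|[|[|//]]] _; rewrite !inE; lia.
Qed.

(** The line consists of the origin and q - 1 multiples of one vector, and e is the value of R
    there. The first property of e serves to count the whole line. *)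
Lemma sum_line_zeros a b (R : F -> F -> bool) :
  (forall s x y, s != 0 -> R (s * x) (s * y) = R x y) -> R 0 0 ->
  (a != 0) || (b != 0) ->
  exists e : bool, ((R =2 (fun _ _ => true)) -> e) /\
  (\sum_y \sum_z ((a * y + b * z == 0)%R && R y z) = 1 + q.-1 * e)%N.
Proof.
move=> RZ R0 ab.
have fZ s x y : s != 0 ->
    (a * (s * x) + b * (s * y) == 0) && R (s * x) (s * y) = (a * x + b * y == 0) && R x y.
  move=> s0; rewrite RZ // (_ : _ + _ = s * (a * x + b * y)); last by ring.
  by rewrite mulf_eq0 (negPf s0).
rewrite (sum_cone2 (f := fun y z => (a * y + b * z == 0) && R y z)) //= !mulr0 addr0 eqxx R0 !mulr1.
have [a0|a0] := eqVneq a 0.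
  rewrite a0 eqxx /= in ab *; exists (R 1 0); split; first by move=> ->.
  rewrite addr0 eqxx big1 ?addn0 // => t _.
  by rewrite mul0r add0r (negPf ab).
rewrite addr0 (negPf a0) /= add0n; exists (R (- b / a) 1); split; first by move=> ->.
rewrite (bigD1 (- b / a)) //= mulrC divfK // addNr eqxx big1 ?addn0 // => t tE.
case: eqP => // /eqP; rewrite addr_eq0 => /eqP E; case/eqP: tE.
by rewrite -E [a * t]mulrC mulfK.
Qed.

(* Projection from the rational point (1 : 0 : 0): for fixed (y, z) the equation is linear in x. *)
Lemma sum_ternary_zeros b c (d e g : F) : [|| b != 0, c != 0, d != 0, e != 0 | g != 0] ->
  (\sum_y \sum_z \sum_x
     (b * (x * y) + c * (x * z) + d * y ^+ 2 + e * (y * z) + g * z ^+ 2 == 0)%R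
   \in [:: q; q ^ 2; 2 * q ^ 2 - q])%N.
Proof.
have q1 : (1 < q)%N := finNzRing_gt1 F.
move=> nz; pose R y z := d * y ^+ 2 + e * (y * z) + g * z ^+ 2.
have RZ s y z : s != 0 -> (R (s * y) (s * z) == 0) = (R y z == 0).
  move=> s0; rewrite (_ : R _ _ = s ^+ 2 * R y z); last by rewrite /R; ring.
  by rewrite mulf_eq0 expf_eq0 (negPf s0).
have R00 : R 0 0 == 0 by rewrite /R expr0n /= !mulr0 !addr0.
have E y z : (\sum_x (b * (x * y) + c * (x * z) + d * y ^+ 2 + e * (y * z) + g * z ^+ 2 == 0)%R
  = ~~ (b * y + c * z == 0)%R + q * ((b * y + c * z == 0)%R && (R y z == 0)%R))%N.
  transitivity (\sum_x (x * (b * y + c * z) + R y z == 0)%R)%N.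
    by apply: eq_bigr => x _; congr (nat_of_bool (_ == 0)); rewrite /R; ring.
  have [->|L0] := eqVneq (b * y + c * z) 0; last by rewrite sum_linear_zeros // muln0.
  under eq_bigr do rewrite mulr0 add0r.
  by rewrite sum_all_bool.
under eq_bigr do under eq_bigr do rewrite E.
under eq_bigr do rewrite big_split -big_distrr /=.
rewrite big_split -big_distrr /=.
(* If b y + c z is a nonzero form, the q^2 - q pairs off its zero line contribute 1 each; on the
   line, R vanishes at 1 or q pairs, which contribute q each. *)
have [bc|] := boolP ((b != 0) || (c != 0)).
  have [eps [_ ->]] := sum_line_zeros RZ R00 bc.
  have [//|eps' [/(_ _)e' E1]] := @sum_line_zeros b c (fun _ _ => true) _ isT bc.
  rewrite e' // muln1 in E1.
  have : (\sum_(y : F) \sum_(z : F) ~~ (b * y + c * z == 0)%R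
      + \sum_y \sum_z ((b * y + c * z == 0)%R && true) = q * q)%N.
    rewrite -big_split /= -sum_nat_const; apply: eq_bigr => y _.
    rewrite -big_split /= -[RHS]mul1n -[RHS]mulnC -sum_nat_const; apply: eq_bigr => z _.
    by case: (_ == 0).
  rewrite E1 => E2.
  move: E2; move: (\sum_(y : F) _)%N => X; case: #|F| q1 => // k _ /=; rewrite add1n => E2.
  by rewrite !inE -!mulnn; case: eps; rewrite ?muln1 ?muln0; nia.
(* Otherwise x does not occur, and each zero of the binary form R contributes q. *)
rewrite negb_or !negbK => /andP [/eqP b0 /eqP c0].
rewrite b0 c0 !eqxx /= in nz *.
have -> : (\sum_(y : F) \sum_(z : F) ((0 * y + 0 * z == 0)%R && (R y z == 0)%R)
    = \sum_y \sum_z (R y z == 0)%R)%N.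
  by apply: eq_bigr => y _; apply: eq_bigr => z _; rewrite !mul0r addr0 eqxx.
rewrite big1 ?add0n; last by move=> y _; rewrite big1 // => z _; rewrite !mul0r addr0 eqxx.
have := sum_binary_zeros nz; rewrite -/(R _ _) !inE => /or3P [] /eqP ->;
  rewrite -!mulnn; move: #|F| q1 => k; nia.
Qed.

Lemma sum_vec3 (G : 'rV[F]_3 -> nat) :
  (\sum_v G v = \sum_y \sum_z \sum_x G (vec3 x y z))%N.
Proof.
rewrite !pair_bigA /= (reindex (fun r : F * F * F => vec3 r.2 r.1.1 r.1.2)) //.
apply: onW_bij; exists (fun v : 'rV[F]_3 => (v 0 1, v 0 2%:R, v 0 0)) => [[[y z] x]|v].
  by rewrite !mxE.
by rewrite vec3K.
Qed.

(** The value 1 means that the conic has no rational point; this case is left open here and is ruled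
    out by the moments in [spectrum1_quads]. *)
Lemma card_conic_zeros (A : 'M[F]_3) : (exists v, conic A v != 0) ->
  (#|[set v | conic A v == 0%R]| \in [:: 1; q; q ^ 2; 2 * q ^ 2 - q])%N.
Proof.
move=> [w w0].
have [/existsP [p /andP [p0 /eqP Ap]]|none] :=
    boolP [exists p : 'rV[F]_3, (p != 0) && (conic A p == 0)]; last first.
  suff -> : [set v | conic A v == 0] = [set 0] by rewrite cards1.
  apply/setP => v; rewrite !inE; have [->|v0] := eqVneq v 0.
    by rewrite /conic !mul0mx mxE eqxx.
  by apply: contraNF none => Av; apply/existsP; exists v; rewrite v0.
(* Moving the zero p to (1 : 0 : 0) kills the coefficient of x ^+ 2. *)
pose M := row_ebase p; have uM : M \in unitmx := row_ebase_unit p.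
pose A' := M *m A *m M^T.
have AE v : conic A (v *m M) = conic A' v by rewrite conicM.
have A00 : A' 0 0 = 0.
  (* The rank normal form of the nonzero row [p] makes it a nonzero multiple of the first row of
     [M]. *)
  have := mulmx_ebase p; rewrite rank_rV p0 => Ep.
  have {}Ep : p = (col_ebase p 0 0) *: (vec3 1 0 0 *m M).
    rewrite -{1}Ep [col_ebase p]mx11_scalar mul_scalar_mx -scalemxAl mxE eqxx mulr1n.
    congr (_ *: (_ *m _)); apply/rowP => i; rewrite !mxE /=.
    by case: i => [[|[|[|//]]] ?].
  have c0 : col_ebase p 0 0 != 0.
    by apply: contraNneq p0 => c0; rewrite Ep c0 scale0r.
  move: Ap; rewrite Ep conicZ AE conic_vec3 expr1n !mulr0 expr0n /= !mulr0 !addr0 mulr1.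
  by move/eqP; rewrite mulf_eq0 expf_eq0 /= (negPf c0) => /eqP.
have -> : #|[set v | conic A v == 0]| = #|[set v | conic A' v == 0]|.
  rewrite -(card_imset [set v | conic A' v == 0] (can_inj (mulmxK uM))); apply: eq_card => v.
  rewrite inE; apply/idP/imsetP => [Av|[u]].
    by exists (v *m invmx M); rewrite ?mulmxKV // inE -AE mulmxKV.
  by rewrite inE -AE => Au ->.
have -> : #|[set v | conic A' v == 0]| =
    (\sum_y \sum_z \sum_x ((A' 0 1 + A' 1 0) * (x * y) + (A' 0 2%:R + A' 2%:R 0) * (x * z)
  + A' 1 1 * y ^+ 2 + (A' 1 2%:R + A' 2%:R 1) * (y * z) + A' 2%:R 2%:R * z ^+ 2 == 0)%R)%N.
  rewrite -sum1_card big_mkcond /= sum_vec3.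
  apply: eq_bigr => y _; apply: eq_bigr => z _; apply: eq_bigr => x _.
  by rewrite inE conic_vec3 A00 mul0r add0r; case: (_ == 0).
rewrite inE; apply/orP; right; apply: sum_ternary_zeros.
apply: contraNT w0; rewrite !negb_or !negbK => /and5P [/eqP h1 /eqP h2 /eqP h3 /eqP h4 /eqP h5].
rewrite -[w](mulmxKV uM) AE -(vec3K (_ *m _)) conic_vec3 A00 h1 h2 h3 h4 h5.
by rewrite !mul0r !addr0.
Qed.

End CountConic.

(** * Conics through given points *)

Lemma subset_of_card (T : finType) (B : {set T}) m : (m <= #|B|)%N ->
  exists A : {set T}, A \subset B /\ #|A| = m.
Proof.
move=> mB; have : (0 < #|[set A : {set T} | A \subset B & #|A| == m]|)%N.
  by rewrite cards_draws bin_gt0.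
by move/card_gt0P => [A]; rewrite inE => /andP [? /eqP ?]; exists A.
Qed.

Section Geometry.
Variables (F : finFieldType) (n : nat) (P : 'I_n -> 'rV[F]_3).
Hypothesis hP : projective_plane_reps P.
Local Notation q := #|F|.
Local Notation C := (veronese_code P).
Implicit Types (i j k l x y : 'I_n) (T : {set 'I_n}) (u : 'cV[F]_3).

Definition line i j : {set 'I_n} := [set k | (P k <= col_mx (P i) (P j))%MS].

Lemma lineP i j k :
  reflect (exists s t, P k = s *: P i + t *: P j) (k \in line i j).
Proof.
rewrite inE; apply: (iffP submxP) => [[w ->]|[s [t ->]]].
  exists (lsubmx w 0 0), (rsubmx w 0 0).
  by rewrite -{1}[w]hsubmxK mul_row_col {1}[lsubmx w]mx11_scalar {1}[rsubmx w]mx11_scalar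
     !mul_scalar_mx.
by exists (row_mx s%:M t%:M); rewrite mul_row_col !mul_scalar_mx.
Qed.

(** The span of P i and P j has q^2 - 1 nonzero vectors, q - 1 for each point. *)
Lemma card_line i j : i != j -> #|line i j| = q.+1.
Proof.
move=> ij; pose M := col_mx (P i) (P j).
have q1 : (1 < q)%N := finNzRing_gt1 F.
have inj : injective (fun w : 'rV[F]_2 => w *m M).
  have freeM : row_free M.
    apply/inj_row_free => w; rewrite -[w](@hsubmxK _ 1 1 1) mul_row_col.
    rewrite [lsubmx _]mx11_scalar [rsubmx _]mx11_scalar !mul_scalar_mx.
    set s := lsubmx _ _ _; set t := rsubmx _ _ _ => E.
    have s0 : s = 0.
      apply: contraNeq ij => s0; apply/eqP/(reps_inj hP (a := - (s^-1 * t))).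
      move/eqP: E; rewrite addr_eq0 => /eqP E.
      by rewrite scaleNr -scalerA -scalerN -E scalerA mulVf ?scale1r.
    rewrite s0 scale0r add0r in E *; move/eqP: E.
    rewrite scaler_eq0 (negPf (reps_neq0 hP j)) orbF => /eqP ->.
    by apply/rowP => a; rewrite !mxE; case: splitP => b _; rewrite !mxE mul0rn.
  by move=> w w' /(row_free_inj freeM).
have S0 : #|[set v : 'rV[F]_3 | (v <= M)%MS]| = (q ^ 2)%N.
  transitivity #|{:'rV[F]_2}|; last by rewrite card_mx mul1n.
  rewrite -(card_imset {:'rV[F]_2} inj); apply: eq_card => v; rewrite inE.
  by apply/submxP/imsetP => [[w ->]|[w _ ->]]; exists w.
have MZ a (v : 'rV[F]_3) : a != 0 -> (a *: v <= M)%MS = (v <= M)%MS.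
  by move=> a0; rewrite eqmx_scale.
have := card_cone hP MZ.
rewrite (_ : [set v | (v != 0) && (v <= M)%MS] = [set v : 'rV[F]_3 | (v <= M)%MS] :\ 0); last first.
  by apply/setP => v; rewrite !inE.
move: (cardsD1 0 [set v : 'rV[F]_3 | (v <= M)%MS]); rewrite inE sub0mx S0 -/(line i j).
move: #|_ :\ _| #|line i j| #|F| q1 => a m p p1 E1 E2.
move: E1; rewrite E2 -mulnn; case: p p1 {E2} => [|[|p]] //= _ E1.
nia.
Qed.

(* u is the equation of a line. *)
Definition avoidable T i :=
  exists u, (forall x, x \in T -> (P x *m u) 0 0 = 0) /\ (P i *m u) 0 0 != 0.

(** The columns of [cokermx M] are linear forms that vanish on the row space of M and have no other
    common zero, so one of them is nonzero at P i. *)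
Lemma avoidable_submx m (M : 'M[F]_(m, 3)) i : ~~ (P i <= M)%MS ->
  avoidable [set x | (P x <= M)%MS] i.
Proof.
have E x b : (P x *m col b (cokermx M)) 0 0 = (P x *m cokermx M) 0 b.
  by rewrite !mxE; apply: eq_bigr => y _; rewrite mxE.
rewrite submxE => /matrix0Pn [a [b ab]]; rewrite ord1 in ab.
exists (col b (cokermx M)); split; last by rewrite E.
by move=> x; rewrite inE submxE E => /eqP ->; rewrite mxE.
Qed.

Lemma avoidable1 i j : i != j -> avoidable [set i] j.
Proof.
move=> ij; have [|u [hu uj]] := @avoidable_submx 1 (P i) j.
  apply: contraNN ij => /sub_rVP [a E]; apply/eqP; exact/esym/(reps_inj hP E).
by exists u; split=> // x; rewrite !inE => /eqP ->; apply: hu; rewrite inE.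
Qed.

Lemma avoidable_line i j k : k \notin line i j -> avoidable (line i j) k.
Proof. by rewrite inE; apply: avoidable_submx. Qed.

Lemma avoidable0 i : avoidable set0 i.
Proof.
have [|u [hu uj]] := @avoidable_submx 3 0 i; first by rewrite submx0 (reps_neq0 hP).
by exists u; split=> // x; rewrite inE.
Qed.

(** The product of the two line equations is a conic through T that misses i, so i imposes a new
    condition. *)
Lemma dim_avoidable T T1 T2 i : avoidable T1 i -> avoidable T2 i -> T \subset T1 :|: T2 ->
  \dim (shortened C T) = (\dim (shortened C (i |: T))).+1.
Proof.
move=> [u [hu ui]] [w [hw wi]] /subsetP sT.
pose c : 'rV[F]_n := \row_j conic (u *m w^T) (P j).
apply: (@dim_shortenedU1_sep _ _ _ _ _ c); last by rewrite mxE conic_forms mulf_neq0.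
apply/shortenedP; split.
  by apply/mem_veronese_code; exists (u *m w^T) => j; rewrite mxE.
move=> j /sT; rewrite !inE mxE conic_forms.
by case/orP => [/hu -> | /hw ->]; rewrite ?mul0r ?mulr0.
Qed.

(** Remove a point i: the other points, at most two, lie on two lines that miss i, so
    [dim_avoidable] applies. *)
Lemma dim_shortened_small T : (#|T| <= 3)%N -> (\dim (shortened C T) = 6 - #|T|)%N.
Proof.
have [m] := ubnP #|T|; elim: m T => // m IH T Tm T3.
have [->|[i iT]] := set_0Vmem T; first by rewrite shortened0 (dim_veronese_code hP) cards0.
have cT := cardsD1 i T; rewrite iT in cT.
have : exists T1 T2, [/\ avoidable T1 i, avoidable T2 i & T :\ i \subset T1 :|: T2].
  have: #|T :\ i| \in [:: 0; 1; 2]%N by move: cT T3; rewrite !inE; lia.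
  rewrite !inE => /or3P [].
  - rewrite cards_eq0 => /eqP ->; exists set0, set0.
    by split; rewrite ?sub0set //; exact: avoidable0.
  - case/cards1P => a Ta; have := setD11 i T; rewrite Ta inE => /negbT ia.
    exists [set a], set0; rewrite setU0; split => //; last exact: avoidable0.
    by apply: avoidable1; rewrite eq_sym.
  - move=> /cards2P [a [b [ab Ta]]]; have := setD11 i T; rewrite Ta !inE => /negbT.
    rewrite negb_or => /andP [ia ib].
    by exists [set a], [set b]; split => //; apply: avoidable1; rewrite eq_sym.
move=> [T1 [T2 [h1 h2 h3]]]; have := dim_avoidable h1 h2 h3; rewrite setD1K // IH; lia.
Qed.

(* In the basis P i, P j of the line the conic is a multiple of the product of the two coordinates,
   which is nonzero at P k. *)
Lemma vanishing_line c i j k : i != j -> k != i -> k != j -> k \in line i j -> c \in C ->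
  c 0 i = 0 -> c 0 j = 0 -> c 0 k = 0 -> forall x, x \in line i j -> c 0 x = 0.
Proof.
move=> ij ki kj /lineP [s [t E]] /mem_veronese_code [A hA].
rewrite !hA => ci cj; rewrite E conicD ci cj !mulr0 add0r addr0 => /eqP.
rewrite mulf_eq0 => /orP [|/eqP B0]; last first.
  by move=> x /lineP [s' [t' E']]; rewrite hA E' conicD ci cj B0 !mulr0 !addr0.
rewrite mulf_eq0 => /orP [] /eqP s0; rewrite s0 scale0r ?add0r ?addr0 in E.
  by rewrite (reps_inj hP E) eqxx in kj.
by rewrite (reps_inj hP E) eqxx in ki.
Qed.

Lemma dim_shortened_ge r D T : D \in subcodes C r -> T \subset zeros D ->
  (r <= \dim (shortened C T))%N.
Proof.
rewrite inE => /andP [sD /eqP <-] sT; apply: dimvS.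
by rewrite sub_shortened sD.
Qed.

(** Three base points would leave only dimension 3 < r, and at most three points impose independent
    conditions. *)
Lemma card_zeros_small r D : (4 <= r)%N -> D \in subcodes C r -> (#|zeros D| + r <= 6)%N.
Proof.
move=> r4 Dr.
have [z3|z3] := leqP 3 #|zeros D|.
  have [T [sT cT]] := subset_of_card z3.
  by have := dim_shortened_ge Dr sT; rewrite dim_shortened_small cT //; lia.
have := dim_shortened_ge Dr (subxx _); rewrite dim_shortened_small; lia.
Qed.

(** The conics through three points already form a net, so three base points determine a net. *)
Lemma subcode3_eq D T : D \in subcodes C 3 -> T \subset zeros D -> #|T| = 3%N -> D = shortened C T.
Proof.
rewrite inE => /andP [sD /eqP dD] sT cT; apply/eqP.
by rewrite eqEdim sub_shortened sD sT dD dim_shortened_small cT.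
Qed.

Lemma zeros_shortened T : T \subset zeros (shortened C T).
Proof. by apply/subsetP => i iT; apply/zerosP => v /shortenedP [_ ->]. Qed.

Lemma card3 i j k : i != j -> k != i -> k != j -> #|[set i; j; k]| = 3%N.
Proof. by move=> ij ki kj; rewrite setUC cardsU1 cards2 !inE negb_or ki kj ij. Qed.

Lemma sub_line_single i j k : [set i; j; k] \subset line i j :|: [set k].
Proof.
apply/subsetP => x; rewrite !inE => /orP [/orP [] /eqP ->|->]; rewrite ?orbT //.
  by apply/orP; left; apply/submxP; exists (row_mx 1%:M 0); rewrite mul_row_col mul1mx mul0mx addr0.
by apply/orP; left; apply/submxP; exists (row_mx 0 1%:M); rewrite mul_row_col mul1mx mul0mx add0r.
Qed.

(** D contains all conics through i, j, k. If l were off the line ij, that line and a line through k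
    missing l would form a member of D that misses l. *)
Lemma zeros3_line D i j k l : D \in subcodes C 3 -> i != j -> k != i -> k != j -> l != k ->
  [set i; j; k] \subset zeros D -> l \in zeros D -> l \in line i j.
Proof.
move=> D3 ij ki kj lk sT lD; apply: contraTT lD => /avoidable_line h1.
have h2 : avoidable [set k] l by apply: avoidable1; rewrite eq_sym.
have := dim_avoidable h1 h2 (sub_line_single i j k).
rewrite (dim_shortenedU1 C _ l) -(subcode3_eq D3 sT (card3 ij ki kj)).
by case: (l \in _) => //=; lia.
Qed.

Lemma line_sub_zeros D i j k : (D <= C)%VS -> i != j -> k != i -> k != j -> k \in line i j ->
  [set i; j; k] \subset zeros D -> line i j \subset zeros D.
Proof.
move=> /subvP sD ij ki kj kl /subsetP s; apply/subsetP => x xl; apply/zerosP => c cD.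
have h y : y \in [set i; j; k] -> c 0 y = 0 by move/s/zerosP; apply.
by apply: (vanishing_line ij ki kj) => //; first exact: sD; apply: h; rewrite !inE eqxx ?orbT.
Qed.

Lemma three_points T : (3 <= #|T|)%N ->
  exists i j k, [/\ i != j, k != i, k != j & [set i; j; k] \subset T].
Proof.
move=> /subset_of_card [A [sA /eqP]]; rewrite eqn_leq => /andP [_ A3].
have [i iA] : exists i, i \in A by apply/card_gt0P/(leq_trans _ A3).
have A2 : (1 < #|A :\ i|)%N by move: A3; rewrite (cardsD1 i) iA add1n ltnS.
have [j [k [jA kA jk]]] := card_gt1P A2.
move: jA kA; rewrite !inE => /andP [ji jA] /andP [ki kA].
exists i, j, k; split => //; rewrite 1?eq_sym //.
by apply: subset_trans sA; apply/subsetP => x; rewrite !inE => /orP [/orP []|] /eqP ->.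
Qed.

(** A fourth base point forces i, j, k to be collinear by [zeros3_line]; then their whole line
    consists of base points, and the same lemma excludes base points off it. *)
Lemma card_zeros_net D : D \in subcodes C 3 -> (4 <= #|zeros D|)%N -> #|zeros D| = q.+1.
Proof.
move=> D3 z4.
have [i [j [k [ij ki kj sT]]]] := three_points (ltnW z4).
have [l] : exists l, l \in zeros D :\: [set i; j; k].
  by apply/card_gt0P; move: z4; rewrite -(cardsID [set i; j; k]) (setIidPr sT) card3 //; lia.
rewrite in_setD in_setU in_set2 in_set1 !negb_or -!andbA => /and4P [li lj lk lD].
have [iD jD kD] : [/\ i \in zeros D, j \in zeros D & k \in zeros D].
  by split; apply: (subsetP sT); rewrite !inE eqxx ?orbT.
have sT' : [set i; j; l] \subset zeros D.
  by apply/subsetP => x; rewrite in_setU in_set2 in_set1 => /orP [/orP []|] /eqP ->.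
have kl : k \in line i j by apply: (zeros3_line D3 ij li lj _ sT' kD); rewrite eq_sym.
rewrite -(card_line ij); apply/eqP; rewrite eqn_leq !subset_leq_card //; last first.
  apply/subsetP => x xD; have [-> //|xk] := eqVneq x k.
  exact: (zeros3_line D3 ij ki kj xk sT xD).
by apply: line_sub_zeros sT => //; move: D3; rewrite inE => /andP [].
Qed.

End Geometry.

(** * Numbers of base points *)

Section Spectra.
Variables (F : finFieldType) (n : nat) (P : 'I_n -> 'rV[F]_3).
Hypothesis hP : projective_plane_reps P.
Hypothesis q4 : (4 <= #|F|)%N.
Local Notation q := #|F|.
Local Notation C := (veronese_code P).
Implicit Types (i j k l x y : 'I_n) (T : {set 'I_n}) (D E : {vspace 'rV[F]_n}).

Lemma zeros_mono D E : (D <= E)%VS -> zeros E \subset zeros D.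
Proof.
move=> /subvP s; apply/subsetP => i /zerosP h; apply/zerosP => v /s; exact: h.
Qed.

(* The nets consisting of the products of a fixed line with all lines. *)
Definition line_nets : {set {vspace 'rV[F]_n}} :=
  [set E in subcodes C 3 | #|zeros E| == q.+1].

(* Otherwise the five points have no three collinear, and two lines through four of them avoid the
   fifth, so the five points impose independent conditions. *)
Lemma pencil_collinear D : D \in subcodes C 2 -> (5 <= #|zeros D|)%N ->
  exists i j k, [/\ i != j, k != i & k != j] /\
    [/\ i \in zeros D, j \in zeros D, k \in zeros D & k \in line P i j].
Proof.
move=> D2 z5.
have [T [sT cT]] := subset_of_card z5.
have [i [j [k [ij ki kj sijk]]]] :
    exists i j k, [/\ i != j, k != i, k != j & [set i; j; k] \subset T].
  by apply: three_points; rewrite cT.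
have c2 : (1 < #|T :\: [set i; j; k]|)%N.
  by move: cT; rewrite -(cardsID [set i; j; k]) (setIidPr sijk) card3 //;
  move: #|_ :\: _| => m; lia.
have [l [m [lT mT lm]]] := card_gt1P c2.
move: lT mT; rewrite !in_setD !in_setU !in_set1 !negb_or -!andbA.
move=> /and4P [li lj lk /(subsetP sT) lD] /and4P [mi mj mk /(subsetP sT) mD].
have [iD jD kD] : [/\ i \in zeros D, j \in zeros D & k \in zeros D].
  by split; apply/(subsetP sT)/(subsetP sijk); rewrite !inE eqxx ?orbT.
have [lij|lij] := boolP (l \in line P i j); first by exists i, j, l; split; split.
have [mij|mij] := boolP (m \in line P i j); first by exists i, j, m; split; split.
have [mkl|mkl] := boolP (m \in line P k l).
  by exists k, l, m; split; split => //; rewrite eq_sym.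
have d3 : \dim (shortened C [set i; j; k]) = 3%N.
  by rewrite (dim_shortened_small hP) card3.
(* First l imposes a condition, by the line ij and a line through k; then m does, by the lines ij
   and kl. The conics through all five points have dimension 1, too small for a pencil. *)
have hk : avoidable P [set k] l by apply: (avoidable1 hP); rewrite eq_sym.
have := dim_avoidable (avoidable_line lij) hk (sub_line_single P i j k).
rewrite d3 => d2.
have sub : l |: [set i; j; k] \subset line P i j :|: line P k l.
  apply/subsetP => x; rewrite in_setU1 => xT; rewrite in_setU.
  have sl a b : [set a; b] \subset line P a b.
    apply/subsetP => z; rewrite in_set2 => /orP [] /eqP ->; apply/lineP.
      by exists 1, 0; rewrite scale1r scale0r addr0.
    by exists 0, 1; rewrite scale1r scale0r add0r.
  move: xT; rewrite in_setU in_set1.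
  case/or3P => [xl|xij|xk]; apply/orP; [right|left|right].
  - by apply: (subsetP (sl k l)); rewrite in_set2 xl orbT.
  - exact: (subsetP (sl i j)).
  - by apply: (subsetP (sl k l)); rewrite in_set2 xk.
have := dim_avoidable (avoidable_line mij) (avoidable_line mkl) sub => d1.
have sT' : m |: (l |: [set i; j; k]) \subset zeros D.
  apply/subsetP => x; rewrite !in_setU1 in_setU in_set2 in_set1.
  by move=> /or3P [/eqP -> //|/eqP -> //|/orP [/orP [] /eqP -> //|/eqP ->]].
by have := dim_shortened_ge D2 sT'; move: d2; rewrite d1 => -[<-].
Qed.

(** E is the net of conics through three collinear base points of D. Two base points of D off their
    line would impose two further conditions on E, leaving dimension 1. *)
Lemma line_net_of_pencil D : D \in subcodes C 2 -> (5 <= #|zeros D|)%N ->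
  exists E, [/\ E \in line_nets, (D <= E)%VS & (#|zeros D :\: zeros E| <= 1)%N].
Proof.
move=> D2 z5.
have [i [j [k [[ij ki kj] [iD jD kD kij]]]]] := pencil_collinear D2 z5.
have c3 : #|[set i; j; k]| = 3%N by rewrite card3.
pose E := shortened C [set i; j; k].
have sC : (E <= C)%VS by apply: capvSl.
have sijk : [set i; j; k] \subset zeros D.
  by apply/subsetP => x; rewrite in_setU in_set2 in_set1 => /orP [/orP []|] /eqP ->.
have DC : (D <= C)%VS by move: D2; rewrite inE => /andP [].
have DE : (D <= E)%VS by rewrite sub_shortened DC.
have dE : \dim E = 3%N by rewrite (dim_shortened_small hP) c3.
have E3 : E \in subcodes C 3 by rewrite inE sC dE.
have lE : line P i j \subset zeros E by apply: line_sub_zeros (zeros_shortened _ _).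
have zE : #|zeros E| = q.+1.
  apply: (card_zeros_net hP E3); apply: leq_trans (subset_leq_card lE).
  by rewrite (card_line hP) // ltnW.
exists E; split => //; first by rewrite inE E3 zE eqxx.
rewrite leqNgt; apply/negP => /card_gt1P [x [y [xD yD xy]]].
move: xD yD; rewrite !in_setD => /andP [xE xD] /andP [yE yD].
have xl : x \notin line P i j by apply: contraNN xE; apply/subsetP.
have yl : y \notin line P i j by apply: contraNN yE; apply/subsetP.
have sl : [set i; j; k] \subset line P i j.
  have kl : [set k] \subset line P i j by rewrite sub1set.
  by have := sub_line_single P i j k; rewrite (setUidPl kl).
have := dim_avoidable (avoidable_line xl) (avoidable0 hP x)
   (subset_trans sl (subsetUl _ _)).
rewrite -/E dE => d2.
have := dim_avoidable (T := x |: [set i; j; k]) (avoidable_line yl) (avoidable1 hP xy).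
rewrite [_ :|: [set x]]setUC setUS // => /(_ isT) d1.
have sT : y |: (x |: [set i; j; k]) \subset zeros D by rewrite !subUset !sub1set yD xD iD jD kD.
by have := dim_shortened_ge D2 sT; move: d2; rewrite d1 => -[<-].
Qed.

Lemma zeros_subcode2 D : D \in subcodes C 2 ->
  #|zeros D| \in [:: q.+2; q.+1; 4; 3; 2; 1; 0]%N.
Proof.
move=> D2; have [z4|z5] := leqP #|zeros D| 4.
  by move: #|zeros D| z4 => m; rewrite !inE; lia.
have [E [EL DE]] := line_net_of_pencil D2 z5.
move: EL; rewrite inE => /andP [_ /eqP zE].
have := cardsID (zeros E) (zeros D); rewrite (setIidPr (zeros_mono DE)) zE => <-.
by move: #|_ :\: _| => m; rewrite !inE; lia.
Qed.

Lemma zeros_subcode3 D : D \in subcodes C 3 -> #|zeros D| \in [:: q.+1; 3; 2; 1; 0]%N.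
Proof.
move=> D3; have [z4|] := leqP 4 #|zeros D|.
  by rewrite (card_zeros_net hP D3 z4) !inE eqxx.
by move: #|zeros D| => m; rewrite !inE; lia.
Qed.

(** Both sets of q + 1 base points lie among the at most q + 2 base points of D, so they share at
    least q >= 3 points, and three base points determine a net. *)
Lemma line_net_unique D E E' : D \in subcodes C 2 -> E \in line_nets -> E' \in line_nets ->
  (D <= E)%VS -> (D <= E')%VS -> E = E'.
Proof.
move=> D2 /setIdP [E3 /eqP zE] /setIdP [E3' /eqP zE'] DE DE'.
have zD : (#|zeros D| <= q.+2)%N.
  have := zeros_subcode2 D2; rewrite !inE; move: #|zeros D| q4 => m; lia.
have zI : (3 <= #|zeros E :&: zeros E'|)%N.
  have := cardsUI (zeros E) (zeros E'); rewrite zE zE'.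
  have : (#|zeros E :|: zeros E'| <= #|zeros D|)%N.
    by apply: subset_leq_card; rewrite subUset !zeros_mono.
  move: q4 zD; move: #|_ :|: _| #|_ :&: _| #|zeros D| #|F| => *; lia.
have [T [sT cT]] := subset_of_card zI.
move: sT; rewrite subsetI => /andP [sE sE'].
by rewrite (subcode3_eq hP E3 sE cT) (subcode3_eq hP E3' sE' cT).
Qed.

(** By [zeros_subcode2] the threshold 5 leaves only q + 1 and q + 2 base points: a line, and
    possibly one point off it. *)
Definition line_pencils : {set {vspace 'rV[F]_n}} :=
  [set D in subcodes C 2 | (5 <= #|zeros D|)%N].

Lemma sum_line_nets (f : {vspace 'rV[F]_n} -> {vspace 'rV[F]_n} -> nat) :
  (\sum_(E in line_nets) \sum_(D in subcodes E 2) f D E =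
   \sum_(D in line_pencils) \sum_(E in line_nets | (D <= E)%VS) f D E)%N.
Proof.
rewrite (exchange_big_dep [in line_pencils]) /=; last first.
  move=> E D /setIdP [/setIdP [EC _] /eqP zE] /setIdP [DE dD]; apply/setIdP; split.
    by apply/setIdP; rewrite (subv_trans DE EC).
  by apply: leq_trans (subset_leq_card (zeros_mono DE)); rewrite zE.
apply: eq_bigr => D /setIdP [/setIdP [_ dD] _].
by apply: eq_bigl => E; rewrite [D \in _]inE dD andbT.
Qed.

(** Existence and uniqueness of the net around D, stated so that the inner sum in [sum_line_nets]
    collapses to one term. *)
Lemma line_pencil_net D : D \in line_pencils ->
  exists2 E, (#|zeros D| = q.+1 + #|zeros D :\: zeros E|)%N /\ (#|zeros D :\: zeros E| <= 1)%N &
  forall f : {vspace 'rV[F]_n} -> nat, (\sum_(E in line_nets | (D <= E)%VS) f E = f E)%N.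
Proof.
rewrite inE => /andP [D2 z5]; have [E [EL DE zDE]] := line_net_of_pencil D2 z5.
exists E; first split => //.
  have := cardsID (zeros E) (zeros D); rewrite (setIidPr (zeros_mono DE)).
  by move: EL; rewrite inE => /andP [_ /eqP ->].
move=> f; rewrite (big_pred1 E) // => E' /=; apply/andP/eqP => [[EL' DE']|-> //].
exact: (line_net_unique D2).
Qed.

Lemma card_line_pencils :
  (#|line_pencils| = spectrum_zeros C 2 q.+1 + spectrum_zeros C 2 q.+2)%N.
Proof.
rewrite /spectrum_zeros -cardsUI.
rewrite [in X in (_ + X)%N](_ : _ :&: _ = set0) ?cards0 ?addn0; last first.
  apply/setP => D; rewrite in_setI 2![D \in [set _ in _ | _]]inE in_set0.
  case: (D \in subcodes C 2) => //=; apply/negP => /andP [/eqP ->].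
  by rewrite eqn_leq ltnn andbF.
apply: eq_card => D; rewrite in_setU 3!inE -andb_orr.
case D2: (D \in subcodes C 2) => //=; have := zeros_subcode2 D2.
rewrite !inE; move: #|zeros D| #|F| q4 => m p p4 E; apply/idP/idP; lia.
Qed.

(** Each pencil with a line of base points lies in exactly one net of [line_nets], and every pencil
    inside such a net has that line among its base points. *)
Lemma card_pencils_lines :
  (spectrum_zeros C 2 q.+1 + spectrum_zeros C 2 q.+2 =
   \sum_(E in line_nets) #|subcodes E 2|)%N.
Proof.
rewrite -card_line_pencils -sum1_card.
under [RHS]eq_bigr do rewrite -sum1_card.
rewrite sum_line_nets; apply: eq_bigr => D /line_pencil_net [E _ ->] //.
Qed.

(* Both sides count the triples (E, D, x) with D a pencil in the net E of a line and x a base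
   point of D off that line. *)
Lemma card_pencils_point_line :
  (spectrum_zeros C 2 q.+2 = #|line_nets| * (n - q.+1))%N.
Proof.
transitivity (\sum_(E in line_nets) \sum_(D in subcodes E 2) #|zeros D :\: zeros E|)%N.
  (* Each D in [line_pencils] contributes its number of base points off the line: 1 if it has q + 2
     base points, 0 if it has q + 1. *)
  rewrite sum_line_nets /spectrum_zeros -sum1_card big_mkcond [RHS]big_mkcond /=.
  apply: eq_bigr => D _; case DL: (D \in line_pencils).
    have [E [zD zDE] ->] := line_pencil_net DL.
    move: DL => /setIdP [D2 _]; rewrite inE D2 zD.
    by move: #|_ :\: _| zDE {zD} => [|[|m]] //= _; rewrite ?addn0 ?addn1 ?eqxx ?ltn_eqF.
  case: ifP => // /setIdP [D2 /eqP zD].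
  by rewrite inE D2 zD /= !ltnS (ltnW q4) in DL.
rewrite -sum_nat_const; apply: eq_bigr => E; rewrite inE => /andP [E3 /eqP zE].
have dE : \dim E = 3%N by move: E3; rewrite inE => /andP [_ /eqP].
transitivity (\sum_(x in ~: zeros E) #|[set D in subcodes E 2 | x \in zeros D]|)%N.
  under eq_bigr do rewrite -sum1_card big_mkcond.
  rewrite exchange_big [RHS]big_mkcond; apply: eq_bigr => x _ /=.
  rewrite -sum1_card; case xE: (x \in zeros E).
    by rewrite in_setC xE big1 // => D _; rewrite in_setD xE.
  rewrite in_setC xE big_mkcond [RHS]big_mkcond; apply: eq_bigr => D _ /=.
  by rewrite in_setD xE [D \in [set _ in _ | _]]inE; case: (D \in subcodes E 2).
(* For x off the line, the members of E through x form the only pencil in E with base point x. *)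
rewrite (eq_bigr (fun=> 1%N)); last first.
  move=> x; rewrite in_setC => xE; apply/eqP/cards1P; exists (E :&: vanishing_at F x)%VS.
  have dW : \dim (E :&: vanishing_at F x) = 2%N.
    by have := dim_cap_vanishing E x; rewrite dE xE addn1 => -[].
  apply/setP => D; apply/setIdP/set1P => [[]|->].
    rewrite inE => /andP [DE /eqP dD] /zerosP h; apply/eqP.
    rewrite eqEdim subv_cap DE dD dW leqnn andbT; apply/subvP => v vD.
    by rewrite mem_vanishing_at h.
  split; first by rewrite inE capvSl dW eqxx.
  by apply/zerosP => v; rewrite memv_cap mem_vanishing_at => /andP [_ /eqP].
by rewrite sum1_card cardsCs setCK card_ord zE.
Qed.

(** Remove 0 from the 1, q, q^2 or 2q^2 - q zero vectors of a generator of D and divide by q - 1. *)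
Lemma zeros_subcode1 D : D \in subcodes C 1 -> #|zeros D| \in [:: q.*2.+1; q.+1; 1; 0]%N.
Proof.
rewrite inE => /andP [sD /eqP dD].
have [c cD c0] : exists2 c, c \in D & c != 0.
  by exists (vpick D); rewrite ?memv_pick // vpick0 -dimv_eq0 dD.
have DE : D = <[c]>%VS.
  by apply/esym/eqP; rewrite eqEdim dim_vline c0 dD -memvE cD.
have /mem_veronese_code [A hA] := subvP sD _ cD.
have -> : zeros D = [set i | conic A (P i) == 0].
  apply/setP => i; rewrite [RHS]inE -hA; apply/zerosP/eqP => [h|h v]; first exact: h.
  by rewrite DE => /vlineP [a ->]; rewrite mxE h mulr0.
have [i ci] : exists i, conic A (P i) != 0.
  have [i ci] : exists i, c 0 i != 0.
    apply/existsP; apply: contraNT c0 => /existsPn h; apply/eqP/rowP => i.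
    by rewrite mxE; apply/eqP; have := h i; rewrite negbK.
  by exists i; rewrite -hA.
have AZ a v : a != 0 -> (conic A (a *: v) == 0) = (conic A v == 0).
  by move=> a0; rewrite conicZ mulf_eq0 expf_eq0 (negPf a0).
have := card_cone hP AZ.
have -> : [set v | (v != 0) && (conic A v == 0)] = [set v | conic A v == 0] :\ 0.
  by apply/setP => v; rewrite !inE.
have := card_conic_zeros (ex_intro (fun v => conic A v != 0) _ ci).
have z0 : 0 \in [set v | conic A v == 0] by rewrite inE /conic !mul0mx mxE.
rewrite (cardsD1 0 [set v | conic A v == 0]) z0.
rewrite !inE -!mulnn; move: #|_ :\ _| #|[set i | _]| #|F| q4 => a m p p4.
case: p p4 => // p p4 /=; rewrite -muln2.
by case/or4P => /eqP E E'; apply/or4P;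
  [apply: Or44|apply: Or43|apply: Or42|apply: Or41]; nia.
Qed.

End Spectra.

(** * Gaussian and ordinary binomials as rational numbers *)

Definition gauss (Q : rat) k r : rat :=
  \prod_(i < r) (Q ^+ k - Q ^+ i) / \prod_(i < r) (Q ^+ r - Q ^+ i).

Lemma natr_card_subcodes (F : finFieldType) (n : nat) (W : {vspace 'rV[F]_n}) r :
  #|subcodes W r|%:R = gauss #|F|%:R (\dim W) r.
Proof.
have q1 : (1 < #|F|)%N := finNzRing_gt1 F.
have prodE k : (\prod_(i < r) (#|F| ^ k - #|F| ^ i))%N%:R
    = \prod_(i < r) (#|F|%:R ^+ k - #|F|%:R ^+ i) :> rat.
  (* For k < r the truncated differences need not agree with the rational ones, but the factor i = k
     makes both products 0. *)
  have [rk|kr] := leqP r k.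
    rewrite natr_prod; apply: eq_bigr => i _; rewrite natrB ?natrX // leq_exp2l //.
    by rewrite ltnW // (leq_trans _ rk).
  by rewrite (bigD1 (Ordinal kr)) //= subnn mul0n (bigD1 (Ordinal kr)) //= subrr mul0r.
apply: canRL (mulfK _) _; last by rewrite -!prodE -natrM card_subspaces.
apply/prodf_neq0 => i _; rewrite subr_eq0 -!natrX eqr_nat eqn_exp2l //.
by rewrite neq_ltn ltn_ord orbT.
Qed.

Section Gauss.
Variables (Q : rat) (Q2 : 2 <= Q).

Lemma gauss_denom_neq0 r : \prod_(i < r) (Q ^+ r - Q ^+ i) != 0.
Proof.
apply/prodf_neq0 => i _; rewrite subr_eq0 eq_sym lt_eqF // ltr_eXn2l ?ltn_ord //.
exact: lt_le_trans Q2.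
Qed.

Lemma gaussE k r (g : rat) :
  \prod_(i < r) (Q ^+ k - Q ^+ i) = g * \prod_(i < r) (Q ^+ r - Q ^+ i) -> gauss Q k r = g.
Proof. by move=> E; rewrite /gauss E mulfK // gauss_denom_neq0. Qed.

Lemma gauss_diag r : gauss Q r r = 1.
Proof. by apply: gaussE; rewrite mul1r. Qed.

Lemma gauss_lt k r : (k < r)%N -> gauss Q k r = 0.
Proof.
by move=> kr; apply: gaussE; rewrite mul0r (bigD1 (Ordinal kr)) //= subrr mul0r.
Qed.

Ltac gauss_tac := apply: gaussE; rewrite !big_ord_recl !big_ord0 /= /bump /=; ring.

Lemma gauss_2_1 : gauss Q 2 1 = 1 + Q. Proof. gauss_tac. Qed.
Lemma gauss_3_1 : gauss Q 3 1 = 1 + Q + Q ^+ 2. Proof. gauss_tac. Qed.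
Lemma gauss_4_1 : gauss Q 4 1 = 1 + Q + Q ^+ 2 + Q ^+ 3. Proof. gauss_tac. Qed.
Lemma gauss_5_1 : gauss Q 5 1 = 1 + Q + Q ^+ 2 + Q ^+ 3 + Q ^+ 4. Proof. gauss_tac. Qed.
Lemma gauss_6_1 : gauss Q 6 1 = 1 + Q + Q ^+ 2 + Q ^+ 3 + Q ^+ 4 + Q ^+ 5. Proof. gauss_tac. Qed.
Lemma gauss_3_2 : gauss Q 3 2 = 1 + Q + Q ^+ 2. Proof. gauss_tac. Qed.
Lemma gauss_4_2 : gauss Q 4 2 = (1 + Q ^+ 2) * (1 + Q + Q ^+ 2). Proof. gauss_tac. Qed.
Lemma gauss_5_2 : gauss Q 5 2 = (1 + Q ^+ 2) * (1 + Q + Q ^+ 2 + Q ^+ 3 + Q ^+ 4).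
Proof. gauss_tac. Qed.
Lemma gauss_6_2 : gauss Q 6 2 = (1 + Q ^+ 2 + Q ^+ 4) * (1 + Q + Q ^+ 2 + Q ^+ 3 + Q ^+ 4).
Proof. gauss_tac. Qed.
Lemma gauss_4_3 : gauss Q 4 3 = 1 + Q + Q ^+ 2 + Q ^+ 3. Proof. gauss_tac. Qed.
Lemma gauss_5_3 : gauss Q 5 3 = (1 + Q ^+ 2) * (1 + Q + Q ^+ 2 + Q ^+ 3 + Q ^+ 4).
Proof. gauss_tac. Qed.
Lemma gauss_6_3 : gauss Q 6 3 =
  (1 + Q ^+ 3) * (1 + Q ^+ 2) * (1 + Q + Q ^+ 2 + Q ^+ 3 + Q ^+ 4).
Proof. gauss_tac. Qed.
Lemma gauss_5_4 : gauss Q 5 4 = 1 + Q + Q ^+ 2 + Q ^+ 3 + Q ^+ 4. Proof. gauss_tac. Qed.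
Lemma gauss_6_4 : gauss Q 6 4 = (1 + Q ^+ 2 + Q ^+ 4) * (1 + Q + Q ^+ 2 + Q ^+ 3 + Q ^+ 4).
Proof. gauss_tac. Qed.
Lemma gauss_6_5 : gauss Q 6 5 = 1 + Q + Q ^+ 2 + Q ^+ 3 + Q ^+ 4 + Q ^+ 5. Proof. gauss_tac. Qed.

End Gauss.

(* For t > 4 this is a junk value. *)
Definition binr (x : rat) t : rat :=
  match t with
  | 0 => 1 | 1 => x | 2 => x * (x - 1) / 2 | 3 => x * (x - 1) * (x - 2) / 6
  | _ => x * (x - 1) * (x - 2) * (x - 3) / 24
  end.

Lemma natr_bin m t : (t <= 4)%N -> 'C(m, t)%:R = binr m%:R t.
Proof.
elim: m t => [|m IH] [|[|[|[|[|//]]]]] _; rewrite ?bin0 ?bin1 ?bin0n ?mulr0n /binr ?mul0r //.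
all: by rewrite binS natrD !IH // -natr1 /binr; field.
Qed.

(** * Solving for the spectra *)

Section Solve.
Variables (F : finFieldType) (P : 'I_(#|F| ^ 2 + #|F| + 1) -> 'rV[F]_3).
Hypothesis hP : projective_plane_reps P.
Hypothesis q4 : (4 <= #|F|)%N.
Local Notation q := #|F|.
Local Notation n := (q ^ 2 + q + 1)%N.
Local Notation C := (veronese_code P).
Local Notation Q := (q%:R : rat).
Local Notation A r m := ((spectrum_zeros C r m)%:R : rat).

Let Q4 : 4 <= Q. Proof. by rewrite ler_nat. Qed.
Let Q2 : 2 <= Q. Proof. by apply: le_trans Q4. Qed.

(** Four points impose only three conditions on conics exactly when they are collinear; the
    dimension is what enters the fourth moment. *)
Definition collinear_quads : {set {set 'I_n}} :=
  [set T : {set 'I_n} | #|T| == 4 & \dim (shortened C T) == 3%N].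

(** For t <= 3 all t-sets impose independent conditions, so all terms of the sum over T are
    equal. *)
Lemma moment r t (s : seq nat) : (t <= 3)%N -> uniq s ->
  (forall D, D \in subcodes C r -> #|zeros D| \in s) ->
  \sum_(m <- s) A r m * binr m%:R t = binr n%:R t * gauss Q (6 - t) r.
Proof.
move=> t3 us hs; transitivity ((\sum_(m <- s) spectrum_zeros C r m * 'C(m, t))%N%:R : rat).
  by rewrite natr_sum; apply: eq_bigr => m _; rewrite natrM natr_bin // leqW.
have nb : 'C(n, t)%:R = binr n%:R t by rewrite natr_bin // leqW.
rewrite -nb.
rewrite -(sum_zeros (fun m => 'C(m, t)) us hs) moment_zeros natr_sum.
rewrite (eq_bigr (fun=> gauss Q (6 - t) r)); last first.
  by move=> T /eqP cT; rewrite natr_card_subcodes (dim_shortened_small hP) cT.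
rewrite sumr_const mulr_natl; congr (_ *+ _).
by rewrite -[in RHS](card_ord n) -card_draws; apply: eq_card => T; rewrite !inE.
Qed.

Lemma moment4 r (s : seq nat) : uniq s ->
  (forall D, D \in subcodes C r -> #|zeros D| \in s) ->
  \sum_(m <- s) A r m * binr m%:R 4 =
  #|collinear_quads|%:R * gauss Q 3 r + (binr n%:R 4 - #|collinear_quads|%:R) * gauss Q 2 r.
Proof.
move=> us hs; transitivity ((\sum_(m <- s) spectrum_zeros C r m * 'C(m, 4))%N%:R : rat).
  by rewrite natr_sum; apply: eq_bigr => m _; rewrite natrM natr_bin.
rewrite -natr_bin //.
rewrite -(sum_zeros (fun m => 'C(m, 4)) us hs) moment_zeros natr_sum.
pose B := [set T : {set 'I_n} | #|T| == 4].
have cB : #|B| = 'C(n, 4) by rewrite -[in RHS](card_ord n) -card_draws.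
have sB : collinear_quads \subset B by apply/subsetP => T /setIdP [T4 _]; rewrite inE.
rewrite (eq_bigl [in B]); last by move=> T; rewrite inE.
rewrite (big_setID collinear_quads) /= (setIidPr sB).
rewrite (eq_bigr (fun=> gauss Q 3 r)); last first.
  by move=> T /setIdP [_ /eqP dT]; rewrite natr_card_subcodes dT.
rewrite sumr_const mulr_natl; congr (_ + _).
rewrite (eq_bigr (fun=> gauss Q 2 r)); last first.
  move=> T; rewrite in_setD !inE => /andP [dT T4]; rewrite T4 /= in dT.
  rewrite natr_card_subcodes; congr (gauss _ _ _).
  (* Three of the points leave dimension 3 and the fourth lowers it by at most 1, so a dimension
     other than 3 is 2. *)
  have [i iT] : exists i, i \in T by apply/card_gt0P; rewrite (eqP T4).
  have T3 : #|T :\ i| = 3%N by have := cardsD1 i T; rewrite iT (eqP T4) add1n => -[].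
  have := dim_shortenedU1 C (T :\ i) i; rewrite setD1K // (dim_shortened_small hP) T3 //.
  by move: dT; case: (_ \notin _); move: (\dim _) => [|[|[|[|d]]]].
rewrite sumr_const -[LHS]mulr_natl cardsD (setIidPr sB) natrB ?subset_leq_card //.
by rewrite cB.
Qed.


Lemma natr_q1 : q.+1%:R = Q + 1. Proof. by rewrite natr1. Qed.
Lemma natr_q2 : q.+2%:R = Q + 2. Proof. by rewrite -addn2 natrD. Qed.
Lemma natr_2q1 : q.*2.+1%:R = 2 * Q + 1. Proof. by rewrite -natr1 -muln2 natrM mulrC. Qed.
Lemma natr_n : n%:R = Q ^+ 2 + Q + 1. Proof. by rewrite !natrD natrX. Qed.
Definition castE := (natr_n, natr_q1, natr_q2, natr_2q1, mulr0n, mulr1n).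

Lemma spectrum6 : A 6 0 = 1.
Proof.
have hs D : D \in subcodes C 6 -> #|zeros D| \in [:: 0]%N.
  by move/(card_zeros_small hP); rewrite inE; lia.
have := moment (isT : 0 <= 3)%N (isT : uniq [:: 0%N]) hs.
by rewrite big_seq1 gauss_diag // !mulr1.
Qed.

Lemma spectrum5 : A 5 1 = Q ^+ 2 + Q + 1 /\ A 5 0 = Q ^+ 5 + Q ^+ 4 + Q ^+ 3.
Proof.
have hs D : D \in subcodes C 5 -> #|zeros D| \in [:: 1; 0]%N.
  by move/(card_zeros_small hP); rewrite !inE; lia.
have us : uniq [:: 1; 0]%N by [].
have e0 := moment (isT : 0 <= 3)%N us hs.
have e1 := moment (isT : 1 <= 3)%N us hs.
move: e0 e1; rewrite !big_cons !big_nil /binr !castE /= gauss_6_5 // gauss_diag // => e0 e1.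
split; lra.
Qed.

Lemma spectrum4 :
  [/\ A 4 2 = (Q ^+ 4 + 2 * Q ^+ 3 + 2 * Q ^+ 2 + Q) / 2,
      A 4 1 = Q ^+ 6 + 2 * Q ^+ 5 + 2 * Q ^+ 4 + Q ^+ 3 + Q ^+ 2 + Q + 1
    & A 4 0 = (2 * Q ^+ 8 + 2 * Q ^+ 7 + 2 * Q ^+ 6 + Q ^+ 4 - Q) / 2].
Proof.
have hs D : D \in subcodes C 4 -> #|zeros D| \in [:: 2; 1; 0]%N.
  by move/(card_zeros_small hP); rewrite !inE; lia.
have us : uniq [:: 2; 1; 0]%N by [].
have e0 := moment (isT : 0 <= 3)%N us hs.
have e1 := moment (isT : 1 <= 3)%N us hs.
have e2 := moment (isT : 2 <= 3)%N us hs.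
move: e0 e1 e2; rewrite !big_cons !big_nil /binr !castE /= gauss_6_4 // gauss_5_4 // gauss_diag //.
move=> e0 e1 e2; split; lra.
Qed.


(** Moments 0 to 3 determine the four spectra; the fourth then yields the number of collinear
    quadruples, which is the number of lines times the number of quadruples on each. *)
Lemma spectrum1_quads :
  [/\ A 1 q.*2.+1 = (Q ^+ 4 + 2 * Q ^+ 3 + 2 * Q ^+ 2 + Q) / 2,
      A 1 q.+1 = Q ^+ 5 + Q + 1, A 1 1 = (Q ^+ 4 - Q) / 2, A 1 0 = 0
    & #|collinear_quads|%:R = (Q ^+ 2 + Q + 1) * ((Q + 1) * Q * (Q - 1) * (Q - 2) / 24)].
Proof.
have hs D : D \in subcodes C 1 -> #|zeros D| \in [:: q.*2.+1; q.+1; 1; 0]%N.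
  exact: zeros_subcode1.
have us : uniq [:: q.*2.+1; q.+1; 1; 0]%N.
  by move: q4; rewrite /= !inE; move: #|F| => p; lia.
have e0 := moment (isT : 0 <= 3)%N us hs.
have e1 := moment (isT : 1 <= 3)%N us hs.
have e2 := moment (isT : 2 <= 3)%N us hs.
have e3 := moment (isT : 3 <= 3)%N us hs.
have e4 := moment4 us hs.
move: e0 e1 e2 e3 e4; rewrite !big_cons !big_nil /binr !castE.
rewrite (gauss_6_1 Q2) (gauss_5_1 Q2) (gauss_4_1 Q2) (gauss_3_1 Q2) (gauss_2_1 Q2).
move: (A 1 q.*2.+1) (A 1 q.+1) (A 1 1) (A 1 0) (#|_|%:R) => X Y Z W c; move: Q Q4 => x x4.
have x0 : x != 0 by rewrite gt_eqF //; lra.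
have x1 : x + 1 != 0 by rewrite gt_eqF //; lra.
have x21 : 2 * x + 1 != 0 by rewrite gt_eqF //; lra.
move=> e0 e1 e2 e3 e4.
have eX : X = (x ^+ 4 + 2 * x ^+ 3 + 2 * x ^+ 2 + x) / 2.
  (* Subtracting this from three times the third moment eliminates Y. *)
  have e2' := congr1 ( *%R (x - 1)) e2.
  apply: (mulIf (mulf_neq0 x21 (mulf_neq0 x0 x0))); lra.
rewrite eX in e0 e1 e2 e3 e4.
have eY : Y = x ^+ 5 + x + 1 by apply: (mulIf (mulf_neq0 x1 x0)); lra.
rewrite eY in e0 e1 e2 e3 e4.
have eZ : Z = (x ^+ 4 - x) / 2 by lra.
split=> //; first by lra.
(* The coefficient of [c] in the fourth moment is [gauss Q 3 1 - gauss Q 2 1], that is x^2. *)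
apply: (mulIf (mulf_neq0 x0 x0)); lra.
Qed.

(** In the fourth moment only nets with q + 1 base points count, and [gauss Q 2 3] is 0. So the
    number of collinear quadruples gives the number of these nets, and the lower moments give the
    rest. *)
Lemma spectrum3 :
  [/\ A 3 q.+1 = Q ^+ 2 + Q + 1,
      A 3 3 = (Q ^+ 6 + 2 * Q ^+ 5 + 2 * Q ^+ 4 + Q ^+ 3) / 6,
      A 3 2 = (Q ^+ 7 + 2 * Q ^+ 6 + 3 * Q ^+ 5 + 3 * Q ^+ 4 + 2 * Q ^+ 3 + Q ^+ 2) / 2,
      A 3 1 = (2 * Q ^+ 8 + 2 * Q ^+ 7 + 3 * Q ^+ 6 + 2 * Q ^+ 5 + 4 * Q ^+ 4
           + 3 * Q ^+ 3 + 2 * Q ^+ 2) / 2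
    & A 3 0 = (6 * Q ^+ 9 + 3 * Q ^+ 7 + 2 * Q ^+ 6 + Q ^+ 5 - 5 * Q ^+ 4
           + 2 * Q ^+ 3 - 3 * Q ^+ 2) / 6].
Proof.
have [_ _ _ _ c4] := spectrum1_quads.
have hs := zeros_subcode3 hP q4.
have us : uniq [:: q.+1; 3; 2; 1; 0]%N.
  by move: q4; rewrite /= !inE; move: #|F| => p; lia.
have e0 := moment (isT : 0 <= 3)%N us hs.
have e1 := moment (isT : 1 <= 3)%N us hs.
have e2 := moment (isT : 2 <= 3)%N us hs.
have e3 := moment (isT : 3 <= 3)%N us hs.
have e4 := moment4 us hs.
move: e0 e1 e2 e3 e4; rewrite c4 !big_cons !big_nil /binr !castE.
rewrite (gauss_6_3 Q2) (gauss_5_3 Q2) (gauss_4_3 Q2) !(gauss_diag Q2) (gauss_lt Q2) //.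
move: (A 3 q.+1) (A 3 3) (A 3 2) (A 3 1) (A 3 0) => X Y Z W V; move: Q Q4 => x x4.
have x0 : (x + 1) * x * (x - 1) * (x - 2) != 0.
  by apply: lt0r_neq0; do !apply: mulr_gt0; lra.
move=> e0 e1 e2 e3 e4.
have eX : X = x ^+ 2 + x + 1.
  apply: (mulIf x0); lra.
rewrite eX in e0 e1 e2 e3 *; split; lra.
Qed.

(** Seven unknowns face five moments, so the pencils with a line of base points are counted first,
    from the number of nets in [line_nets]. *)
Lemma spectrum2 :
  [/\ A 2 q.+2 = Q ^+ 4 + Q ^+ 3 + Q ^+ 2, A 2 q.+1 = Q ^+ 3 + 2 * Q ^+ 2 + 2 * Q + 1,
      A 2 4 = (Q ^+ 8 - Q ^+ 6 - Q ^+ 5 + Q ^+ 3) / 24,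
      A 2 3 = (Q ^+ 7 + Q ^+ 6 - Q ^+ 4 - Q ^+ 3) / 2
    & [/\ A 2 2 = (Q ^+ 8 + 5 * Q ^+ 6 + 7 * Q ^+ 5 + 4 * Q ^+ 4 - Q ^+ 3
           - 4 * Q ^+ 2) / 4,
        A 2 1 = (2 * Q ^+ 8 + 3 * Q ^+ 7 + Q ^+ 6 + 4 * Q ^+ 5 + 9 * Q ^+ 4
           + 5 * Q ^+ 3 - 6 * Q) / 6
      & A 2 0 = (3 * Q ^+ 8 + Q ^+ 6 - 3 * Q ^+ 5 - Q ^+ 3) / 8]].
Proof.
have [_ _ _ _ c4] := spectrum1_quads.
have [a3 _ _ _ _] := spectrum3.
have hs := zeros_subcode2 hP q4.
have us : uniq [:: q.+2; q.+1; 4; 3; 2; 1; 0]%N.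
  by move: q4; rewrite /= !inE; move: #|F| => p; lia.
have e0 := moment (isT : 0 <= 3)%N us hs.
have e1 := moment (isT : 1 <= 3)%N us hs.
have e2 := moment (isT : 2 <= 3)%N us hs.
have e3 := moment (isT : 3 <= 3)%N us hs.
have e4 := moment4 us hs.
have eX : A 2 q.+2 = Q ^+ 4 + Q ^+ 3 + Q ^+ 2.
  (* The cardinal of [line_nets] is by definition [spectrum_zeros C 3 q.+1], whose value is [a3]. *)
  rewrite card_pencils_point_line // natrM [X in X * _]a3.
  rewrite (_ : n - q.+1 = q ^ 2)%N; last by lia.
  rewrite natrX; ring.
have eY : A 2 q.+1 = Q ^+ 3 + 2 * Q ^+ 2 + 2 * Q + 1.
  apply: (addIr (A 2 q.+2)); rewrite -natrD card_pencils_lines // natr_sum.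
  rewrite (eq_bigr (fun=> gauss Q 3 2)); last first.
    by move=> E /setIdP [/setIdP [_ /eqP dE] _]; rewrite natr_card_subcodes dE.
  rewrite sumr_const -[LHS]mulr_natl [X in X * _]a3 eX (gauss_3_2 Q2); ring.
move: e0 e1 e2 e3 e4; rewrite !big_cons !big_nil eX eY c4 /binr !castE.
rewrite (gauss_6_2 Q2) (gauss_5_2 Q2) (gauss_4_2 Q2) !(gauss_3_2 Q2) !(gauss_diag Q2).
move: (A 2 4) (A 2 3) (A 2 2) (A 2 1) (A 2 0) => Y Z W V U; move: Q Q4 => x x4.
move=> e0 e1 e2 e3 e4; split=> //.
- lra.
- lra.
split.
- lra.
- lra.
- lra.
Qed.

End Solve.

(** * From numbers of base points to weights *)

Lemma spectrum_zeros_eq0 (F : finFieldType) n (C : {vspace 'rV[F]_n}) r (s : seq nat) m :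
  (forall D, D \in subcodes C r -> #|zeros D| \in s) -> m \notin s ->
  spectrum_zeros C r m = 0%N.
Proof.
move=> hs ms; apply: eq_card0 => D; apply/negbTE; rewrite inE negb_and -implybE.
by apply/implyP => /hs zs; apply: contraNneq ms => <-.
Qed.

(** With m = 4 this is the linear relation between q and q^2 that [lia] needs once q^2 is
    generalized to a variable. *)
Lemma leq_mul_sqr m p : (m <= p)%N -> (m * p <= p ^ 2)%N.
Proof. by move=> mp; rewrite -mulnn leq_mul2r mp orbT. Qed.

Lemma natr_higher_weight (F : finFieldType) n (C : {vspace 'rV[F]_n}) r m w (a : rat) :
  (spectrum_zeros C r m)%:R = a -> (m <= n)%N -> w = (n - m)%N ->
  (higher_weight_spectrum C r w)%:R = a.
Proof. by move=> <- mn ->; rewrite higher_weight_zeros ?leq_subr // subKn. Qed.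

Ltac lia_sqr F q4 :=
  move: q4 (leq_mul_sqr q4); move: (#|F| ^ 2)%N #|F| => s p; lia.

Ltac spectrum_entry F q4 E :=
  case/orP => [/eqP [-> -> ->]|];
    first by apply: (natr_higher_weight E); lia_sqr F q4.

Unset Implicit Arguments.
Set Strict Implicit.
Set Printing Implicit Defensive.

Theorem theorem3p1 (q : nat) (F : finFieldType)
    (P : 'I_(q ^ 2 + q + 1) -> 'rV[F]_3)
    (hq : (4 <= q)%N) (hF : #|F| = q) (hP : projective_plane_reps P) :
  (forall (r w : nat) (a : rat), ((r, w), a) \in veronese_spectra q ->
     (higher_weight_spectrum (veronese_code P) r w)%:R = a)
  /\
  (forall r w : nat, (1 <= r <= 6)%N -> (w <= q ^ 2 + q + 1)%N ->
     (r, w) \notin unzip1 (veronese_spectra q) ->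
     higher_weight_spectrum (veronese_code P) r w = 0%N).
Proof.
subst q.
have [a12 a11 a1 a10 _] := spectrum1_quads hP hq.
have [a22 a21 a24 a23 [a2 a2' a20]] := spectrum2 hP hq.
have [a31 a33 a32 a3 a30] := spectrum3 hP hq.
have [a42 a4 a40] := spectrum4 hP hq.
have [a5 a50] := spectrum5 hP hq.
have a60 := spectrum6 hP hq.
split=> [r w a|r w].
  rewrite /veronese_spectra !in_cons in_nil.
  spectrum_entry F hq a12. spectrum_entry F hq a11. spectrum_entry F hq a1.
  spectrum_entry F hq a22. spectrum_entry F hq a21.
  spectrum_entry F hq a24. spectrum_entry F hq a23. spectrum_entry F hq a2. spectrum_entry F hq a2'.
  spectrum_entry F hq a20.
  spectrum_entry F hq a31. spectrum_entry F hq a33. spectrum_entry F hq a32. spectrum_entry F hq a3.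
  spectrum_entry F hq a30.
  spectrum_entry F hq a42. spectrum_entry F hq a4. spectrum_entry F hq a40.
  spectrum_entry F hq a5. spectrum_entry F hq a50.
  by spectrum_entry F hq a60.
move=> r16 wn key; rewrite higher_weight_zeros //.
move: r16 key; rewrite /veronese_spectra /=.
case: r => [//|[|[|[|[|[|[|//]]]]]]] _; rewrite !inE !xpair_eqE /= => key.
(* For r = 1 the list in [zeros_subcode1] allows 0 base points, a case absent from the table; its
   spectrum vanishes by [a10]. *)
- have [->|m0] := eqVneq (#|F| ^ 2 + #|F| + 1 - w)%N 0%N.
    by apply/eqP; rewrite -(eqr_nat rat) a10.
  apply: spectrum_zeros_eq0 (zeros_subcode1 hP hq) _.
  rewrite !inE; move: wn key m0; lia_sqr F hq.
- apply: spectrum_zeros_eq0 (zeros_subcode2 hP hq) _; rewrite !inE; move: wn key; lia_sqr F hq.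
- apply: spectrum_zeros_eq0 (zeros_subcode3 hP hq) _; rewrite !inE; move: wn key; lia_sqr F hq.
- apply: (@spectrum_zeros_eq0 _ _ _ _ [:: 2; 1; 0]%N);
    last by rewrite !inE; move: wn key; lia_sqr F hq.
  by move=> D /(card_zeros_small hP); move: #|zeros D| {key wn} => m; rewrite !inE; lia.
- apply: (@spectrum_zeros_eq0 _ _ _ _ [:: 1; 0]%N);
    last by rewrite !inE; move: wn key; lia_sqr F hq.
  by move=> D /(card_zeros_small hP); move: #|zeros D| {key wn} => m; rewrite !inE; lia.
- apply: (@spectrum_zeros_eq0 _ _ _ _ [:: 0]%N);
    last by rewrite !inE; move: wn key; lia_sqr F hq.
  by move=> D /(card_zeros_small hP); move: #|zeros D| {key wn} => m; rewrite !inE; lia.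
Qed.
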